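(* Let $G_\Gamma$ and $G_\Omega$ be graph products over finite simplicial graphs $\Gamma,\Omega$ whose vertex groups are finite, non-trivial and directly indecomposable. The following are equivalent: (1) $G_\Gamma\cong G_\Omega$; (2) $\Gamma\cong\Omega$ as vertex-labelled graphs, i.e. there is a graph isomorphism $\Gamma\to\Omega$ such that the vertex group of each vertex of $\Gamma$ is isomorphic to the vertex group of its image; (3) there is an order isomorphism $\psi\colon\mathcal{CF}(G_\Gamma)\to\mathcal{CF}(G_\Omega)$ such that for every $[A]\in\mathcal{CF}(G_\Gamma)$ and every $B\in\psi([A])$ we have $A\cong B$.
   Context: Graph product: for a finite simplicial graph $\Gamma=(V,E)$ with non-trivial vertex groups $G_v$, $G_\Gamma=(\ast_{v\in V}G_v)/\langle\langle [a,b] : a\in G_v,b\in G_w,\{v,w\}\in E\rangle\rangle$. For a group $G$, $\mathcal{CF}(G)$ denotes the set of conjugacy classes of finite subgroups of $G$, partially ordered by $[A]\le[B]$ iff $A\subseteq gBg^{-1}$ for some $g\in G$. *)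

(* Defs.v *)
(* Vertex groups are finite groups (finGroupType);
   the graph product (an infinite group in general) is constructed
   concretely as a quotient of the free monoid on letters (v, a), a in G_v. *)
From HB Require Import structures.
From mathcomp Require Import all_boot all_fingroup.
From Stdlib Require Import ClassicalEpsilon FunctionalExtensionality
  PropExtensionality ProofIrrelevance.
From Stdlib Require List.

Set Implicit Arguments.
Unset Strict Implicit.
Unset Printing Implicit Defensive.

Record grp := Grp {
  gcar :> Type;
  gmul : gcar -> gcar -> gcar;
  gone : gcar;
  ginv : gcar -> gcar;
  gmulA : forall x y z, gmul x (gmul y z) = gmul (gmul x y) z;
  gmul1 : forall x, gmul gone x = x;
  gmulV : forall x, gmul (ginv x) x = gone
}.

Definition grp_iso (G H : grp) : Prop :=
  exists f : G -> H,
    (forall x y, f (gmul x y) = gmul (f x) (f y)) /\ bijective f.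

Definition is_subgroup (G : grp) (A : G -> Prop) : Prop :=
  [/\ A (gone G), (forall x y, A x -> A y -> A (gmul x y))
    & (forall x, A x -> A (ginv x))].

Definition is_finite_subgroup (G : grp) (A : G -> Prop) : Prop :=
  is_subgroup A /\ exists s : list G, forall x, A x -> List.In x s.

Definition subgroup_iso (G H : grp) (A : G -> Prop) (B : H -> Prop) : Prop :=
  exists f : G -> H,
    [/\ (forall x, A x -> B (f x)),
        (forall x y, A x -> A y -> f (gmul x y) = gmul (f x) (f y)),
        (forall x y, A x -> A y -> f x = f y -> x = y)
      & (forall y, B y -> exists x, A x /\ f x = y)].

Definition gconj (G : grp) (x g : G) : G := gmul (ginv g) (gmul x g).

Definition conj_class (G : grp) (A : G -> Prop) : (G -> Prop) -> Prop :=
  fun B => exists g : G, forall x, B x <-> A (gconj x g).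

Definition CF (G : grp) : Type :=
  {C : (G -> Prop) -> Prop | exists A, is_finite_subgroup A /\ C = conj_class A}.

Definition CF_le (G : grp) (c d : CF G) : Prop :=
  exists (A B : G -> Prop) (g : G),
    [/\ proj1_sig c A, proj1_sig d B & forall x, A x -> B (gconj x g)].

Definition CF_labelled_iso (G H : grp) : Prop :=
  exists psi : CF G -> CF H,
    [/\ bijective psi,
        (forall c d, CF_le c d <-> CF_le (psi c) (psi d))
      & (forall c A, proj1_sig c A -> forall B, proj1_sig (psi c) B ->
           subgroup_iso A B)].

Definition simple_graph (V : finType) (e : rel V) : Prop :=
  irreflexive e /\ symmetric e.

Definition directly_indecomposable (gT : finGroupType) : Prop :=
  forall H K : {group gT}, (H \x K)%g = [set: gT] -> (H :=: 1)%g \/ (K :=: 1)%g.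

Definition nontrivial (gT : finGroupType) : Prop := 1 < #|[set: gT]|.

Definition labelled_graph_iso (V1 V2 : finType) (e1 : rel V1) (e2 : rel V2)
    (gT1 : V1 -> finGroupType) (gT2 : V2 -> finGroupType) : Prop :=
  exists sigma : V1 -> V2,
    [/\ bijective sigma,
        (forall x y, e1 x y = e2 (sigma x) (sigma y))
      & (forall v, [set: gT1 v] \isog [set: gT2 (sigma v)])%g].

Section GraphProduct.
Variables (V : finType) (e : rel V) (gT : V -> finGroupType).

Definition letter := {v : V & gT v}.
Definition word := seq letter.

Inductive wrel : word -> word -> Prop :=
| wr_refl w : wrel w w
| wr_sym w w' : wrel w w' -> wrel w' w
| wr_trans w1 w2 w3 : wrel w1 w2 -> wrel w2 w3 -> wrel w1 w3
| wr_ctx u w w' z : wrel w w' -> wrel (u ++ w ++ z) (u ++ w' ++ z)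
| wr_one v : wrel [:: existT _ v (1%g : gT v)] [::]
| wr_mul v (a b : gT v) :
    wrel [:: existT _ v a; existT _ v b] [:: existT _ v (a * b)%g]
| wr_comm v w (a : gT v) (b : gT w) : e v w ->
    wrel [:: existT _ v a; existT _ w b] [:: existT _ w b; existT _ v a].

Definition gp_car : Type := {P : word -> Prop | exists w, P = wrel w}.

Definition gp_rep (P : gp_car) : word :=
  proj1_sig (constructive_indefinite_description _ (proj2_sig P)).

Lemma gp_repP P : proj1_sig P = wrel (gp_rep P).
Proof. exact: (proj2_sig (constructive_indefinite_description _ (proj2_sig P))). Qed.

Definition gp_cl (w : word) : gp_car := exist _ (wrel w) (ex_intro _ w erefl).

Lemma gp_eq (P Q : gp_car) : proj1_sig P = proj1_sig Q -> P = Q.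
Proof.
case: P Q => P hP [Q hQ] /= E; subst Q; f_equal; apply: proof_irrelevance.
Qed.

Lemma gp_cl_eq w w' : wrel w w' -> gp_cl w = gp_cl w'.
Proof.
move=> h; apply: gp_eq => /=; apply: functional_extensionality => x.
apply: propositional_extensionality; split => h'.
  exact: wr_trans (wr_sym h) h'.
exact: wr_trans h h'.
Qed.

Lemma gp_clK P : gp_cl (gp_rep P) = P.
Proof. by apply: gp_eq; rewrite /= -gp_repP. Qed.

Lemma gp_rep_cl w : wrel w (gp_rep (gp_cl w)).
Proof.
have := gp_repP (gp_cl w) => /= E.
by move: (wr_refl (gp_rep (gp_cl w))); rewrite -E.
Qed.

Lemma wrel_cat a a' b b' : wrel a a' -> wrel b b' -> wrel (a ++ b) (a' ++ b').
Proof.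
move=> ha hb; apply: wr_trans (_ : wrel (a' ++ b) _).
  by have := wr_ctx [::] b ha.
by have := wr_ctx a' [::] hb; rewrite !cats0.
Qed.

Definition gp_mul (P Q : gp_car) : gp_car := gp_cl (gp_rep P ++ gp_rep Q).
Definition gp_one : gp_car := gp_cl [::].
Definition linv (x : letter) : letter := existT _ (projT1 x) ((projT2 x)^-1)%g.
Definition winv (w : word) : word := rev (map linv w).
Definition gp_inv (P : gp_car) : gp_car := gp_cl (winv (gp_rep P)).

Lemma gp_mul_cl w w' : gp_mul (gp_cl w) (gp_cl w') = gp_cl (w ++ w').
Proof.
apply: gp_cl_eq; apply: wr_sym; apply: wrel_cat; exact: gp_rep_cl.
Qed.

Lemma gp_mulA x y z : gp_mul x (gp_mul y z) = gp_mul (gp_mul x y) z.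
Proof.
rewrite -(gp_clK x) -(gp_clK y) -(gp_clK z) !gp_mul_cl; by rewrite catA.
Qed.

Lemma gp_mul1 x : gp_mul gp_one x = x.
Proof. by rewrite -(gp_clK x) /gp_one gp_mul_cl. Qed.

Lemma winv_l w : wrel (winv w ++ w) [::].
Proof.
elim: w => [|[v a] w IH]; first exact: wr_refl.
rewrite /winv map_cons rev_cons -cats1 -/(winv w) -catA.
apply: wr_trans IH.
have h : wrel ([:: linv (existT _ v a)] ++ [:: existT _ v a]) [::].
  apply: wr_trans (wr_one v); rewrite /linv /=.
  by rewrite -(mulVg a); apply: wr_mul.
have := wr_ctx (winv w) w h; by rewrite catA.
Qed.

Lemma gp_mulV x : gp_mul (gp_inv x) x = gp_one.
Proof.
rewrite /gp_inv; set r := gp_rep x; rewrite -{1}(gp_clK x) -/r gp_mul_cl.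
exact: gp_cl_eq (winv_l r).
Qed.

Definition graph_product : grp := Grp gp_mulA gp_mul1 gp_mulV.

End GraphProduct.

(* Main.v *)
From mathcomp Require Import all_boot all_fingroup.
From Stdlib Require Import ClassicalEpsilon FunctionalExtensionality
  PropExtensionality ProofIrrelevance.
From Stdlib Require List.
Require Import Defs.

Set Implicit Arguments.
Unset Strict Implicit.
Unset Printing Implicit Defensive.

(** A graph isomorphism preserving vertex groups maps generators to generators
    and relations to relations, and a group isomorphism transports conjugacy
    classes of finite subgroups; the content is the recovery of the labelled
    graph from the labelled poset.

    Deleting the letters outside a vertex set [L] is a retraction of the graph
    product onto the special subgroup [G_L].  If [v] and [w] are not adjacent,
    the graph product is the amalgam of [G_(V - v)] and [G_(V - w)] over
    [G_(V - v - w)], which is a retract of both factors; a finite subgroup fixes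
    a point of the Bass-Serre tree, so by induction it is conjugate into [G_K]
    for a clique [K].  Hence the maximal classes are those of the [G_K] with [K] a
    maximal clique, and by the retractions the meet of the classes of such
    subgroups is the class of [G_I] with [I] the intersection of the cliques.
    An order isomorphism thus matches maximal cliques, with isomorphic special
    subgroups over corresponding intersections.  By the Krull-Schmidt theorem
    corresponding intersections contain equally many vertices of each
    isomorphism type, hence, by inclusion-exclusion, so do the sets of vertices
    lying in exactly the same maximal cliques. *)

(** * The Krull-Schmidt theorem *)

(** By pigeonhole among the finitely many self-maps two iterates agree, so the iterates are
    eventually periodic; an exponent beyond the preperiod that is a multiple of the period gives an
    idempotent. *)
Lemma iter_idempotent (T : finType) (f : T -> T) :
  exists2 N, 0 < N & forall x, iter N f (iter N f x) = iter N f x.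
Proof.
pose F (i : 'I_#|{ffun T -> T}|.+1) : {ffun T -> T} := [ffun x => iter i f x].
have /injectivePn [a [b ab Fab]] : ~~ injectiveb F.
  apply/negP => /injectiveP /leq_card; by rewrite card_ord ltnn.
have {Fab} Fab x : iter a f x = iter b f x.
  by have := congr1 (fun g : {ffun T -> T} => g x) Fab; rewrite !ffunE.
wlog {ab} ab : a b Fab / a < b.
  move=> W; case: (ltngtP a b) => [|ba|/val_inj E]; first exact: W.
    by apply: (W b a).
  by rewrite E eqxx in ab.
pose p := b - a.
have p0 : 0 < p by rewrite subn_gt0.
have per n x : a <= n -> iter (n + p) f x = iter n f x.
  move=> an; rewrite -(subnKC an) addnAC /p (subnKC (ltnW ab)).
  by rewrite addnC iterD -Fab -iterD addnC subnKC // addnC subnKC.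
have perk k n x : a <= n -> iter (n + k * p) f x = iter n f x.
  move=> an; elim: k => [|k IH]; first by rewrite addn0.
  by rewrite mulSn [p + _]addnC addnA per ?IH // (leq_trans an) ?leq_addr.
(* The exponent is a multiple of the period [p] and at least [a]; the successor keeps it positive
   when [a = 0]. *)
exists (a.+1 * p) => [|x]; first by rewrite muln_gt0.
by rewrite -iterD perk // (leq_trans (leqnSn a)) // leq_pmulr.
Qed.

(** * Fitting's lemma for normal endomorphisms *)

Section Fitting.
Local Open Scope group_scope.
Variable gT : finGroupType.
Implicit Types f g h : gT -> gT.

(** The second clause conjugates by [y] itself, not by [f y]: these are the endomorphisms commuting
    with all inner automorphisms. *)
Definition normal_endo f :=
  {morph f : x y / x * y} /\ forall x y, f (x ^ y) = f x ^ y.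

Lemma morph_one (aT rT : finGroupType) (f : aT -> rT) :
  {morph f : x y / x * y} -> f 1 = 1.
Proof. by move=> fM; apply: (mulgI (f 1)); rewrite -fM !mulg1. Qed.

Lemma morph_inv (aT rT : finGroupType) (f : aT -> rT) :
  {morph f : x y / x * y} -> {morph f : x / x^-1}.
Proof.
move=> fM x; apply: (mulgI (f x)).
by rewrite -fM !mulgV (morph_one fM).
Qed.

Lemma normal_endo_comp f g :
  normal_endo f -> normal_endo g -> normal_endo (f \o g).
Proof.
case=> fM fJ [gM gJ]; split=> x y /=; first by rewrite gM fM.
by rewrite gJ fJ.
Qed.

Lemma normal_endo_iter n f : normal_endo f -> normal_endo (iter n f).
Proof.
move=> fE; elim: n => [|n IH] //; exact: normal_endo_comp fE IH.
Qed.

(** An idempotent iterate of [f] splits the group into the kernel and the fixed points of that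
    iterate, which commute by normality; indecomposability makes one of the two trivial. *)
Lemma fitting f : directly_indecomposable gT -> normal_endo f ->
  (forall x, f x = 1 -> x = 1) \/ (exists n, forall x, iter n f x = 1).
Proof.
move=> ind fE; have [N N0 eI] := iter_idempotent f.
have [eM eJ] := normal_endo_iter N fE; set e := iter N f in eM eJ eI.
have e1 := morph_one eM; have eV := morph_inv eM.
have Kg : group_set [set x | e x == 1].
  apply/group_setP; split=> [|x y]; rewrite !inE ?e1 // eM.
  by move=> /eqP -> /eqP ->; rewrite mulg1.
have Mg : group_set [set x | e x == x].
  apply/group_setP; split=> [|x y]; rewrite !inE ?e1 // eM.
  by move=> /eqP -> /eqP ->.
pose K := Group Kg; pose M := Group Mg.
have TI : K :&: M = 1.
  apply/trivgP/subsetP=> x; rewrite !inE => /andP[/eqP -> /eqP <-] //.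
have cKM : M \subset 'C(K).
  apply/centsP => y; rewrite inE => /eqP ey x; rewrite inE => /eqP ex.
  (* Normality gives [y ^ x = e (y ^ x)], and multiplicativity evaluates the right side to [y],
     since [e x = 1]. *)
  have yx : y ^ x = y by rewrite -{1}ey -eJ conjgE !eM eV ex invg1 mul1g mulg1.
  by rewrite /commute -{2}yx -conjgC.
have KM : K \x M = [set: gT].
  rewrite dprodE //; apply/setP => x; rewrite inE; apply/mulsgP.
  exists (x * (e x)^-1) (e x); rewrite ?mulgKV ?inE ?eI //.
  by rewrite eM eV eI mulgV.
case: (ind _ _ KM) => [K1|M1]; [left => x fx | right; exists N => x].
  have : x \in K by rewrite inE /e -(prednK N0) iterSr fx
    (morph_one (normal_endo_iter _ fE).1).
  by rewrite K1 => /set1P.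
have : e x \in M by rewrite inE eI.
by rewrite M1 => /set1P.
Qed.

(* On [ker f] the maps [g] and [h] agree, so there [h^-1 \o g] is the identity
   and hence is not nilpotent. *)
Lemma normal_endo_sum f g h : directly_indecomposable gT ->
  normal_endo f -> normal_endo g -> normal_endo h ->
  (forall x, h x = f x * g x) -> (forall x, h x = 1 -> x = 1) ->
  (forall x, f x = 1 -> x = 1) \/ (forall x, g x = 1 -> x = 1).
Proof.
move=> ind fE gE hE hfg hI; have [N N0 eI] := iter_idempotent h.
have [eM _] := normal_endo_iter N hE.
have iterI n x : iter n h x = 1 -> x = 1.
  by elim: n x => [|n IH] x //; rewrite iterSr => /IH /hI.
have eid x : iter N h x = x.
  apply: (mulgI (iter N h x)^-1); rewrite mulVg; apply/esym.
  by apply: (iterI N); rewrite eM (morph_inv eM) eI mulVg.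
(* As [iter N h] is the identity, the iterate before it inverts [h]. *)
pose k := iter N.-1 h; have kE : normal_endo k by exact: normal_endo_iter.
have kh x : k (h x) = x by rewrite /k -iterSr prednK.
case: (pickP (fun x => (f x == 1) && (x != 1))) => [x0|none]; last first.
  by left => x fx; move: (none x); rewrite fx eqxx /= => /negbFE /eqP.
case/andP => /eqP fx0 x0N; right => x gx.
have [kgI|[n kgN]] := fitting ind (normal_endo_comp kE gE).
  by apply: kgI; rewrite /= gx (morph_one kE.1).
case/eqP: x0N; rewrite -(kgN x0).
by elim: n {kgN} => [|n IH] //=; rewrite -IH -[g x0]mul1g -fx0 -hfg kh.
Qed.

End Fitting.

(** * Restriction to subsets of coordinates *)

Section DirectProduct.
Local Open Scope group_scope.
Variables (V : finType) (gT : V -> finGroupType).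
Notation P := {dffun forall v, gT v}.
Implicit Types (x y : P) (I : {set V}).

(** The subproduct over [I] is encoded as the fixed points of this projection, so that all
    subproducts live in one group. *)
Definition restr I x : P := [ffun v => if v \in I then x v else 1].

Lemma restrM I : {morph restr I : x y / x * y}.
Proof.
by move=> x y; apply/ffunP => v; rewrite !ffunE; case: ifP; rewrite ?mulg1.
Qed.

Lemma restr_restr I I' x : restr I (restr I' x) = restr (I :&: I') x.
Proof.
by apply/ffunP => v; rewrite !ffunE inE; case: (v \in I).
Qed.

Lemma restrK I x : restr I (restr I x) = restr I x.
Proof. by rewrite restr_restr setIid. Qed.

Lemma restr0 x : restr set0 x = 1.
Proof. by apply/ffunP => v; rewrite !ffunE inE. Qed.

Lemma restr_conj I x y : restr I (x ^ y) = restr I x ^ y.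
Proof.
apply/ffunP => v; rewrite !ffunE; case: ifP => // _.
by rewrite mul1g mulVg.
Qed.

Lemma dffun_conj x y v : (x ^ y) v = x v ^ y v.
Proof. by rewrite !ffunE. Qed.

Lemma dfung1_conj v (a b : gT v) : dfung1 (a ^ b) = dfung1 a ^ dfung1 b.
Proof. by rewrite !conjgE !dfung1_morphM (morph_inv (@dfung1_morphM _ _ v)). Qed.

Lemma restr1E v x : restr [set v] x = dfung1 (x v).
Proof.
apply/ffunP => u; rewrite ffunE inE; case: eqP => [->|/eqP ne].
  by rewrite dfung1_id.
by rewrite dfung1_dflt // eq_sym.
Qed.

Lemma restr_dfung1 I v (a : gT v) : v \in I -> restr I (dfung1 a) = dfung1 a.
Proof.
move=> vI; rewrite -[a in LHS](dfung1_id a) -restr1E restr_restr.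
by rewrite (setIidPr _) ?sub1set // restr1E dfung1_id.
Qed.

Lemma restr_setU1 I v x : v \notin I -> restr (v |: I) x = restr I x * dfung1 (x v).
Proof.
move=> vI; apply/ffunP => u; rewrite -restr1E !ffunE !inE.
case: eqP => [->|_] /=; first by rewrite (negbTE vI) mul1g.
by case: (u \in I); rewrite mulg1.
Qed.

End DirectProduct.

(** * Exchange of indecomposable factors *)

Section KrullSchmidt.
Local Open Scope group_scope.

Notation prod_of gT := {dffun forall v, gT v}.

Definition prod_embed (V W : finType) (gT : V -> finGroupType)
    (hT : W -> finGroupType) (I : {set V}) (J : {set W}) : Prop :=
  exists phi : prod_of gT -> prod_of hT,
    [/\ {morph phi : x y / x * y}, forall x, restr J (phi x) = phi x
      & forall x, restr I x = x -> phi x = 1 -> x = 1].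

Definition prod_inverse (V W : finType) (gT : V -> finGroupType)
    (hT : W -> finGroupType) (I : {set V}) (J : {set W})
    (phi : prod_of gT -> prod_of hT) (psi : prod_of hT -> prod_of gT) : Prop :=
  [/\ {morph phi : x y / x * y}, {morph psi : x y / x * y},
      forall x, restr J (phi x) = phi x, forall y, restr I (psi y) = psi y
    & (forall x, restr I x = x -> psi (phi x) = x) /\
      (forall y, restr J y = y -> phi (psi y) = y)].

Lemma prod_inverse_sym (V W : finType) (gT : V -> finGroupType)
    (hT : W -> finGroupType) (I : {set V}) (J : {set W}) phi psi :
  @prod_inverse V W gT hT I J phi psi -> prod_inverse J I psi phi.
Proof. by case=> ? ? ? ? [? ?]; split. Qed.

Section Two.
Variables (V W : finType) (gT : V -> finGroupType) (hT : W -> finGroupType).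
Implicit Types (I : {set V}) (J : {set W}).

(** Embeddings both ways between finite groups force equal orders, so the first one is already
    onto. *)
Lemma prod_embed_inverse I J : prod_embed gT hT I J -> prod_embed hT gT J I ->
  exists phi psi, @prod_inverse V W gT hT I J phi psi.
Proof.
case=> phi [phiM phiJ phiI] [psi [psiM psiI psiJ]].
pose X := [set x : prod_of gT | restr I x == x].
pose Y := [set y : prod_of hT | restr J y == y].
have inj1 : {in X &, injective phi}.
  move=> x y; rewrite !inE => /eqP xX /eqP yX E.
  apply: (mulgI y^-1); rewrite mulVg; apply: phiI.
    by rewrite restrM (morph_inv (restrM I)) xX yX.
  by rewrite phiM (morph_inv phiM) E mulVg.
have inj2 : {in Y &, injective psi}.
  move=> x y; rewrite !inE => /eqP xX /eqP yX E.
  apply: (mulgI y^-1); rewrite mulVg; apply: psiJ.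
    by rewrite restrM (morph_inv (restrM J)) xX yX.
  by rewrite psiM (morph_inv psiM) E mulVg.
have imX : phi @: X \subset Y.
  by apply/subsetP => _ /imsetP[x _ ->]; rewrite inE phiJ.
have imY : psi @: Y \subset X.
  by apply/subsetP => _ /imsetP[x _ ->]; rewrite inE psiI.
have XY : phi @: X = Y.
  apply/eqP; rewrite eqEcard imX card_in_imset //.
  by rewrite -(card_in_imset inj2) subset_leq_card.
(* Restricting [y] first makes the search succeed for every [y], so the default 1 is never
   reached. *)
pose inv y := odflt 1 [pick x in X | phi x == restr J y].
have invP y : inv y \in X /\ phi (inv y) = restr J y.
  rewrite /inv; case: pickP => [x /andP[xX /eqP]|none] //.
  have : restr J y \in phi @: X by rewrite XY inE restrK.
  by case/imsetP => x xX E; move: (none x); rewrite inE in xX; rewrite inE xX E eqxx.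
exists phi, inv; split=> //.
- move=> x y; have [xX xE] := invP x; have [yX yE] := invP y.
  have [zX zE] := invP (x * y).
  apply: inj1 => //; last by rewrite phiM xE yE zE restrM.
  by move: xX yX; rewrite !inE restrM => /eqP-> /eqP->.
- by move=> y; have [] := invP y; rewrite inE => /eqP.
split=> [x xI | y yJ]; last by have [_ ->] := invP y.
have [iX iE] := invP (phi x).
by apply: inj1 => //; rewrite ?inE ?xI // iE phiJ.
Qed.

Variables (I : {set V}) (J : {set W}).
Variables (phi : prod_of gT -> prod_of hT) (psi : prod_of hT -> prod_of gT).
Hypothesis inv : prod_inverse I J phi psi.

(** The endomorphism of the factor at [i] that crosses to the other product, keeps the coordinates
    in [S] and returns. For [i] in [I] and [S = J] it is the identity, and a disjoint union of sets
    [S] gives a pointwise product. *)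
Let back (i : V) (S : {set W}) (a : gT i) : gT i :=
  psi (restr S (phi (dfung1 a))) i.

(** Restriction commutes with conjugation by any element, here by [phi (dfung1 b)], which [psi]
    turns back into conjugation by [b]. *)
Lemma back_normal i S : i \in I -> normal_endo (@back i S).
Proof.
case: inv => phiM psiM phiJ psiI [phiK psiK] iI; split=> a b; rewrite /back.
  by rewrite dfung1_morphM phiM restrM psiM ffunE.
have conjM (aT rT : finGroupType) (f : aT -> rT) x y :
    {morph f : x y / x * y} -> f (x ^ y) = f x ^ f y.
  by move=> fM; rewrite !conjgE !fM (morph_inv fM).
rewrite dfung1_conj (conjM _ _ phi) // restr_conj (conjM _ _ psi) // dffun_conj.
by rewrite phiK ?restr_dfung1 // dfung1_id.
Qed.

(** Take [S] minimal with [back S] injective. Splitting off some [j] in [S], one of the two summands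
    is injective by [normal_endo_sum], and minimality leaves only the one at [j]. *)
Lemma exchange_injective i : i \in I -> directly_indecomposable (gT i) ->
  nontrivial (gT i) ->
  exists2 j, j \in J & forall a : gT i, @back i [set j] a = 1 -> a = 1.
Proof.
move=> iI ind nt; case: (inv) => phiM psiM phiJ psiI [phiK psiK].
pose injb (S : {set W}) := [forall a : gT i, (back S a == 1) ==> (a == 1)].
have injP S : reflect (forall a : gT i, back S a = 1 -> a = 1) (injb S).
  apply: (iffP forallP) => H a; last by apply/implyP => /eqP /H ->.
  by move=> Ha; apply/eqP; apply: (implyP (H a)); rewrite Ha.
have injJ : injb J.
  apply/injP => a; rewrite /back phiJ phiK ?restr_dfung1 //.
  by rewrite dfung1_id.
have [S /minsetP [SI Smin] SJ] := minset_exists injJ.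
have /set0Pn [j jS] : S != set0.
  apply: contraTneq SI => ->; apply/injP => H.
  move: nt; rewrite /nontrivial; have -> : [set: gT i] = [set 1].
    apply/setP => a; rewrite !inE; apply/esym/eqP/H.
    by rewrite /back restr0 (morph_one psiM) ffunE.
  by rewrite cards1.
exists j; first exact: (subsetP SJ).
have sum (a : gT i) : back S a = back (S :\ j) a * back [set j] a.
  by rewrite /back -{1}(setD1K jS) restr_setU1 ?setD11 // -restr1E psiM ffunE.
have [H|//] := normal_endo_sum ind (back_normal (S :\ j) iI)
  (back_normal [set j] iI) (back_normal S iI) sum (injP _ SI).
have /(Smin _) : injb (S :\ j) by apply/injP.
by move=> /(_ (subsetDl _ _)) E; move: jS; rewrite -E setD11.
Qed.

(** If [x] lies over [I :\ i] and [phi x] vanishes off [j], then [psi] sends this element of the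
    factor at [j] to [x], which is trivial at [i]; by the hypothesis [phi x = 1]. *)
Lemma prod_embed_remove i j :
  (forall b : hT j, psi (dfung1 b) i = 1 -> b = 1) ->
  prod_embed gT hT (I :\ i) (J :\ j).
Proof.
case: inv => phiM psiM phiJ psiI [phiK psiK] H.
exists (fun x => restr (J :\ j) (phi x)); split=> [x y|x|x xI].
- by rewrite phiM restrM.
- by rewrite restrK.
have xII : restr I x = x.
  by rewrite -{1}xI restr_restr (setIidPr _) ?subsetDl.
move=> E; have phx : phi x = dfung1 (phi x j).
  rewrite -{1}phiJ -restr1E; apply/ffunP => u.
  have := congr1 (fun y : prod_of hT => y u) E.
  rewrite !ffunE !inE; case: eqP => [->|_] //=; rewrite ?phiJ.
    by case: ifP => // jJ _; rewrite -phiJ ffunE jJ.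
have : psi (phi x) i = 1 by rewrite phiK // -xI ffunE !inE eqxx.
rewrite phx => /H h1; rewrite -(phiK x) // phx h1.
by rewrite (morph_one (@dfung1_morphM _ _ _)) (morph_one psiM).
Qed.

End Two.

Section Exchange.
Variables (V W : finType) (gT : V -> finGroupType) (hT : W -> finGroupType).
Variables (I : {set V}) (J : {set W}).
Variables (phi : prod_of gT -> prod_of hT) (psi : prod_of hT -> prod_of gT).
Hypothesis inv : prod_inverse I J phi psi.

(** The components [p] and [r] of [phi] and [psi] between the factors at [i] and [j] are both
    injective, hence isomorphisms by counting, and the two factors can be removed together. *)
Lemma exchange i : i \in I ->
  directly_indecomposable (gT i) -> nontrivial (gT i) ->
  (forall j, j \in J -> directly_indecomposable (hT j)) ->
  exists2 j, j \in J &
    [/\ [set: gT i] \isog [set: hT j],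
        prod_embed gT hT (I :\ i) (J :\ j) & prod_embed hT gT (J :\ j) (I :\ i)].
Proof.
move=> iI ind nt indJ.
have [j jJ pI] := exchange_injective inv iI ind nt; exists j => //.
pose p (a : gT i) := phi (dfung1 a) j; pose r (b : hT j) := psi (dfung1 b) i.
case: (inv) => phiM psiM phiJ psiI [phiK psiK].
have pM : {morph p : a b / a * b}.
  by move=> a b; rewrite /p dfung1_morphM phiM ffunE.
have rM : {morph r : a b / a * b}.
  by move=> a b; rewrite /r dfung1_morphM psiM ffunE.
have rpI a : r (p a) = 1 -> a = 1.
  by move=> E; apply: pI; rewrite restr1E.
have prI : forall b, p (r b) = 1 -> b = 1.
  have prE : normal_endo (p \o r).
    have [M C] := back_normal (prod_inverse_sym inv) [set i] jJ.
    split=> a b; first by move: (M a b); rewrite !restr1E.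
    by move: (C a b); rewrite !restr1E.
  have [H|[n H]] := fitting (indJ j jJ) prE; first exact: H.
  (* If [p \o r] were nilpotent, so would be [r \o p], one step later, although it is injective on a
     nontrivial group. *)
  have : forall a, iter n.+1 (r \o p) a = 1.
    move=> a; suff -> : iter n.+1 (r \o p) a = r (iter n (p \o r) (p a)).
      by rewrite H (morph_one rM).
    by elim: n {H} => [|n IH] //; rewrite iterS IH.
  have itI m a : iter m (r \o p) a = 1 -> a = 1.
    by elim: m a => [|m IH] a //; rewrite iterSr => /IH /rpI.
  move=> H1; move: nt; rewrite /nontrivial; have -> : [set: gT i] = [set 1].
    by apply/setP => a; rewrite !inE; apply/esym/eqP/(itI n.+1).
  by rewrite cards1.
have pI1 a : p a = 1 -> a = 1.
  by move=> E; apply: rpI; rewrite E (morph_one rM).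
have rI1 b : r b = 1 -> b = 1.
  by move=> E; apply: prI; rewrite E (morph_one pM).
split; last 2 first.
- exact: prod_embed_remove inv _ _ rI1.
- exact: prod_embed_remove (prod_inverse_sym inv) _ _ pI1.
have p_inj : injective p.
  move=> a b E; apply: (mulgI b^-1); rewrite mulVg; apply: pI1.
  by rewrite pM (morph_inv pM) E mulVg.
have r_inj : injective r.
  move=> a b E; apply: (mulgI b^-1); rewrite mulVg; apply: rI1.
  by rewrite rM (morph_inv rM) E mulVg.
pose pm := @Morphism _ _ [set: gT i] p (in2W pM).
apply/isogP; exists pm; first by apply/injmP => a b _ _; apply: p_inj.
rewrite morphimEdom /=; apply/eqP; rewrite eqEcard subsetT.
by rewrite card_imset // !cardsT; apply: leq_card r_inj.
Qed.
End Exchange.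

Lemma isog_count_remove (V : finType) (gT : V -> finGroupType) (I : {set V})
    (kT : finGroupType) i : i \in I ->
  #|[set v in I | [set: gT v] \isog [set: kT]]| =
    (([set: gT i] \isog [set: kT]) +
     #|[set v in I :\ i | [set: gT v] \isog [set: kT]]|)%N.
Proof.
move=> iI; rewrite (cardsD1 i) !inE iI /=; congr (_ + _)%N.
by apply: eq_card => v; rewrite !inE andbA.
Qed.

(** Induction on the number of factors: [exchange] removes an isomorphic pair and leaves embeddings
    both ways between the remaining subproducts. *)
Theorem krull_schmidt (V W : finType) (gT : V -> finGroupType)
    (hT : W -> finGroupType) (I : {set V}) (J : {set W}) (kT : finGroupType) :
  (forall v, nontrivial (gT v) /\ directly_indecomposable (gT v)) ->
  (forall w, nontrivial (hT w) /\ directly_indecomposable (hT w)) ->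
  prod_embed gT hT I J -> prod_embed hT gT J I ->
  #|[set v in I | [set: gT v] \isog [set: kT]]| =
  #|[set w in J | [set: hT w] \isog [set: kT]]|.
Proof.
move=> gP hP; move En: #|I| => n.
elim: n I J En => [|n IH] I J En IJ JI.
  have I0 : I = set0 by apply/eqP; rewrite -cards_eq0 En.
  have J0 : J = set0.
    apply/setP => j; rewrite inE; apply/negP => jJ.
    have [phi [phiM phiI phiJ]] := JI.
    have [nt _] := hP j; move: nt; rewrite /nontrivial.
    have -> : [set: hT j] = [set 1].
      apply/setP => b; rewrite !inE; apply/esym/eqP.
      rewrite -(dfung1_id b) (phiJ (dfung1 b)) ?ffunE ?restr_dfung1 //.
      by rewrite -phiI I0 restr0.
    by rewrite cards1.
  by rewrite I0 J0; apply/eqP; rewrite eqn_leq; apply/andP; split;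
    apply: leq_trans (_ : 0 <= _) => //; rewrite leqn0 cards_eq0;
    apply/eqP/setP => x; rewrite !inE.
have /set0Pn [i iI] : I != set0 by rewrite -cards_eq0 En.
have [phi [psi inv]] := prod_embed_inverse IJ JI.
have [ntI indI] := gP i.
have [|j jJ [ij IJ' JI']] := exchange inv iI indI ntI.
  by move=> j _; case: (hP j).
rewrite (isog_count_remove _ _ iI) (isog_count_remove _ _ jJ).
rewrite (IH (I :\ i) (J :\ j)) //; last first.
  by apply/eqP; rewrite -(eqn_add2l 1) -[1%N]/(true : nat) -{1}iI -cardsD1 En.
congr (nat_of_bool _ + _)%N; apply/idP/idP; apply: isog_trans => //.
by rewrite isog_symr.
Qed.

End KrullSchmidt.

(** * Groups and conjugacy classes of finite subgroups *)

Lemma exists_choice (A B : Type) (R : A -> B -> Prop) :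
  (forall x, exists y, R x y) -> exists f : A -> B, forall x, R x (f x).
Proof.
move=> H; pose f x := constructive_indefinite_description (R x) (H x).
by exists (fun x => proj1_sig (f x)) => x; apply: (proj2_sig (f x)).
Qed.

Declare Scope grp_scope.
Delimit Scope grp_scope with grp.
Notation "x ** y" := (gmul x y) (at level 40, left associativity) : grp_scope.
Local Open Scope grp_scope.

Section GroupTheory.
Variable G : grp.
Implicit Types x y z g h : G.

Lemma gmulVr x : x ** ginv x = gone G.
Proof.
rewrite -(gmul1 (x ** ginv x)) -{1}(gmulV (ginv x)) -gmulA.
by rewrite (gmulA (ginv x)) gmulV gmul1 gmulV.
Qed.

Lemma gmulr1 x : x ** gone G = x.
Proof. by rewrite -(gmulV x) gmulA gmulVr gmul1. Qed.

Lemma gmulK x y : x ** y ** ginv y = x.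
Proof. by rewrite -gmulA gmulVr gmulr1. Qed.

Lemma gmulKV x y : x ** ginv y ** y = x.
Proof. by rewrite -gmulA gmulV gmulr1. Qed.

Lemma gKmul x y : ginv x ** (x ** y) = y.
Proof. by rewrite gmulA gmulV gmul1. Qed.

Lemma gmul_injl x y z : x ** y = x ** z -> y = z.
Proof. by move=> E; rewrite -(gKmul x y) E gKmul. Qed.

Lemma ginvE x y : x ** y = gone G -> ginv x = y.
Proof. by move=> E; apply: (@gmul_injl x); rewrite gmulVr. Qed.

Lemma ginv1 : ginv (gone G) = gone G.
Proof. by apply: ginvE; rewrite gmul1. Qed.

Lemma ginvK x : ginv (ginv x) = x.
Proof. by apply: ginvE; rewrite gmulV. Qed.

Lemma ginvM x y : ginv (x ** y) = ginv y ** ginv x.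
Proof. by apply: ginvE; rewrite gmulA gmulK gmulVr. Qed.

Lemma gconj1 x : gconj x (gone G) = x.
Proof. by rewrite /gconj ginv1 gmul1 gmulr1. Qed.

Lemma gconjgM x g h : gconj x (g ** h) = gconj (gconj x g) h.
Proof. by rewrite /gconj ginvM !gmulA. Qed.

Lemma gconjMg x y g : gconj (x ** y) g = gconj x g ** gconj y g.
Proof. by rewrite /gconj !gmulA gmulK. Qed.

Lemma gconj1g g : gconj (gone G) g = gone G.
Proof. by rewrite /gconj gmul1 gmulV. Qed.

Lemma gconjK x g : gconj (gconj x g) (ginv g) = x.
Proof. by rewrite -gconjgM gmulVr gconj1. Qed.

Lemma gconjKV x g : gconj (gconj x (ginv g)) g = x.
Proof. by rewrite -gconjgM gmulV gconj1. Qed.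

Lemma gconjV x g : gconj (ginv x) g = ginv (gconj x g).
Proof. by apply/esym/ginvE; rewrite -gconjMg gmulVr gconj1g. Qed.

Lemma gconj_inj g x y : gconj x g = gconj y g -> x = y.
Proof. by move=> E; rewrite -(gconjK x g) E gconjK. Qed.

(** The product of an element of [F] outside [A] and one outside [B] would lie in neither. *)
Lemma subgroup_union (F A B : G -> Prop) : is_subgroup F ->
  is_subgroup A -> is_subgroup B -> (forall x, F x -> A x \/ B x) ->
  (forall x, F x -> A x) \/ (forall x, F x -> B x).
Proof.
case=> _ FM FV [_ AM AV] [_ BM BV] FAB.
case: (excluded_middle_informative (forall x, F x -> A x)) => [|nA]; first by left.
right => y Fy; apply: NNPP => nBy; apply: nA => x Fx; apply: NNPP => nAx.
have Bx : B x by case: (FAB x Fx).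
have Ay : A y by case: (FAB y Fy).
case: (FAB _ (FM _ _ Fx Fy)) => [Axy|Bxy].
  by apply: nAx; rewrite -(gmulK x y); apply: AM => //; apply: AV.
by apply: nBy; rewrite -(gKmul x y); apply: BM => //; apply: BV.
Qed.

Definition sub_conj (A B : G -> Prop) : Prop :=
  exists g, forall x, A x -> B (gconj x g).

Lemma sub_conj_trans A B C : sub_conj A B -> sub_conj B C -> sub_conj A C.
Proof.
by case=> g gP [h hP]; exists (g ** h) => x Ax; rewrite gconjgM; apply/hP/gP.
Qed.

Lemma is_subgroup_conj A g : is_subgroup A ->
  is_subgroup (fun x => A (gconj x g)).
Proof.
case=> A1 AM AV; split=> [|x y Ax Ay|x Ax]; first by rewrite gconj1g.
  by rewrite gconjMg; apply: AM.
by rewrite gconjV; apply: AV.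
Qed.

Lemma is_finite_subgroup_conj A g : is_finite_subgroup A ->
  is_finite_subgroup (fun x => A (gconj x g)).
Proof.
case=> sA [s sP]; split; first exact: is_subgroup_conj.
exists (List.map (fun x => gconj x (ginv g)) s) => x /sP H.
by rewrite -(gconjK x g); apply: (List.in_map (fun x => gconj x (ginv g))).
Qed.

End GroupTheory.

Section Morphisms.
Variables (G H : grp) (f : G -> H).
Hypothesis fM : forall x y, f (x ** y) = f x ** f y.

Lemma gmorph1 : f (gone G) = gone H.
Proof. by apply: (@gmul_injl _ (f (gone G))); rewrite -fM gmul1 gmulr1. Qed.

Lemma gmorphV x : f (ginv x) = ginv (f x).
Proof. by apply/esym/ginvE; rewrite -fM gmulVr gmorph1. Qed.

Lemma gmorphJ x g : f (gconj x g) = gconj (f x) (f g).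
Proof. by rewrite /gconj !fM gmorphV. Qed.

End Morphisms.

Section Embeddings.

(** One-sided, so that an isomorphism between representatives can be followed by a conjugation into
    a larger subgroup. *)
Definition embeds (G H : grp) (A : G -> Prop) (B : H -> Prop) : Prop :=
  exists f : G -> H,
    [/\ forall x, A x -> B (f x),
        forall x y, A x -> A y -> f (x ** y) = f x ** f y
      & forall x y, A x -> A y -> f x = f y -> x = y].

Lemma embeds_trans (G H K : grp) (A : G -> Prop) (B : H -> Prop) (C : K -> Prop) :
  embeds A B -> embeds B C -> embeds A C.
Proof.
case=> f [fB fM fI] [h [hC hM hI]]; exists (fun x => h (f x)); split.
- by move=> x /fB /hC.
- by move=> x y Ax Ay; rewrite fM // hM //; apply: fB.
- by move=> x y Ax Ay E; apply: fI => //; apply: hI => //; apply: fB.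
Qed.

Lemma embeds_sub_conj (G : grp) (A B : G -> Prop) : sub_conj A B -> embeds A B.
Proof.
case=> g gP; exists (fun x => gconj x g); split=> // [x y _ _|x y _ _].
  by rewrite gconjMg.
exact: gconj_inj.
Qed.

Lemma subgroup_iso_embeds (G H : grp) (A : G -> Prop) (B : H -> Prop) :
  subgroup_iso A B -> embeds A B.
Proof. by case=> f [? ? ? _]; exists f. Qed.

Lemma subgroup_iso_embeds_inv (G H : grp) (A : G -> Prop) (B : H -> Prop) :
  is_subgroup A -> subgroup_iso A B -> embeds B A.
Proof.
case=> [A1 AM AV] [f [fB fM fI fS]].
have [h hP] : exists h : H -> G, forall y, B y -> A (h y) /\ f (h y) = y.
  apply: (exists_choice (R := fun y x => B y -> A x /\ f x = y)) => y.
  case: (excluded_middle_informative (B y)) => [/fS [x ?]|nB]; first by exists x.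
  by exists (gone G) => /nB.
exists h; split=> [y /hP[]//|x y|x y].
  move=> Bx By; have [Ax fx] := hP x Bx; have [Ay fy] := hP y By.
  have Bxy : B (x ** y) by rewrite -fx -fy -fM //; apply/fB/AM.
  have [Axy fxy] := hP _ Bxy.
  by apply: fI => //; [apply: AM | rewrite fxy fM // fx fy].
by move=> Bx By E; rewrite -(proj2 (hP x Bx)) E (proj2 (hP y By)).
Qed.

End Embeddings.

Section ConjugacyClasses.
Variable G : grp.

Definition CF_class (A : G -> Prop) (fA : is_finite_subgroup A) : CF G :=
  exist _ (conj_class A) (ex_intro _ A (conj fA erefl)).

Lemma CF_class_mem A (fA : is_finite_subgroup A) : proj1_sig (CF_class fA) A.
Proof. by exists (gone G) => x; rewrite gconj1. Qed.

Lemma CF_memP (c : CF G) : exists2 A, is_finite_subgroup A & proj1_sig c A.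
Proof.
case: c => C [A [fA E]] /=; rewrite E; exists A => //.
by exists (gone G) => x; rewrite gconj1.
Qed.

Lemma CF_mem_finite (c : CF G) A : proj1_sig c A -> is_finite_subgroup A.
Proof.
case: c => C [A0 [fA E]] /=; rewrite E => -[g gP].
have -> : A = (fun x => A0 (gconj x g)).
  by apply: functional_extensionality => x; apply: propositional_extensionality.
exact: is_finite_subgroup_conj.
Qed.

Lemma CF_mem_conj (c : CF G) A B :
  proj1_sig c A -> proj1_sig c B -> sub_conj A B.
Proof.
case: c => C [A0 [fA E]] /=; rewrite E => -[g gP] [h hP].
exists (g ** ginv h) => x /gP Ax; apply/hP; rewrite -gconjgM gmulKV //.
Qed.

Lemma CF_leP (c d : CF G) A B : proj1_sig c A -> proj1_sig d B ->
  CF_le c d <-> sub_conj A B.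
Proof.
move=> cA dB; split=> [[A' [B' [g [cA' dB' gP]]]]|[g gP]]; last by exists A, B, g.
apply: sub_conj_trans (CF_mem_conj cA cA') _.
by apply: sub_conj_trans (CF_mem_conj dB' dB); exists g.
Qed.

Lemma CF_le_trans (c d f : CF G) : CF_le c d -> CF_le d f -> CF_le c f.
Proof.
have [A _ cA] := CF_memP c; have [B _ dB] := CF_memP d.
have [C _ fC] := CF_memP f.
rewrite (CF_leP cA dB) (CF_leP dB fC) (CF_leP cA fC); exact: sub_conj_trans.
Qed.

Lemma CF_eq (c d : CF G) : proj1_sig c = proj1_sig d -> c = d.
Proof.
by case: c d => C hC [D hD] /= E; subst D; f_equal; apply: proof_irrelevance.
Qed.

End ConjugacyClasses.

(** * Transport of classes along a group isomorphism *)

Section Transport.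

(** The image of a family of subgroups under an isomorphism, written with preimages under its
    inverse [h]. *)
Definition preim_family (G H : grp) (h : H -> G) (C : (G -> Prop) -> Prop) :
  (H -> Prop) -> Prop := fun B => exists2 A, C A & B = (fun y => A (h y)).

Variables (G H : grp) (f : G -> H) (h : H -> G).
Hypotheses (fM : forall x y, f (x ** y) = f x ** f y) (fK : cancel f h)
  (hK : cancel h f).

Let hM x y : h (x ** y) = h x ** h y.
Proof. by rewrite -{1}(hK x) -{1}(hK y) -fM fK. Qed.

Lemma transport_subgroup A : is_finite_subgroup A ->
  is_finite_subgroup (fun y => A (h y)).
Proof.
case=> [[A1 AM AV] [s sP]]; split.
  split=> [|x y Ax Ay|x Ax]; first by rewrite (gmorph1 hM).
    by rewrite hM; apply: AM.
  by rewrite (gmorphV hM); apply: AV.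
by exists (List.map f s) => y /sP Hy; rewrite -(hK y); apply: List.in_map.
Qed.

Lemma transport_class A :
  preim_family h (conj_class A) = conj_class (fun y => A (h y)).
Proof.
apply: functional_extensionality => B; apply: propositional_extensionality.
split=> [[A' [g gP] ->]|[g gP]].
  by exists (f g) => y; rewrite (gmorphJ hM) fK.
exists (fun x => A (gconj x (h g))); first by exists (h g) => x.
apply: functional_extensionality => y; apply: propositional_extensionality.
by rewrite -(gmorphJ hM); apply: gP.
Qed.

Lemma transport_ok (c : CF G) : exists B : H -> Prop,
  is_finite_subgroup B /\ preim_family h (proj1_sig c) = conj_class B.
Proof.
case: c => C [A [fA E]] /=; subst C; exists (fun y => A (h y)).
by split; [apply: transport_subgroup | apply: transport_class].
Qed.

Definition CF_transport (c : CF G) : CF H := exist _ _ (transport_ok c).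

End Transport.

Lemma CF_transportK (G H : grp) (f : G -> H) (h : H -> G) fM fK hK hM hK' fK' :
  cancel (@CF_transport G H f h fM fK hK) (@CF_transport H G h f hM hK' fK').
Proof.
move=> c; apply: CF_eq => /=; apply: functional_extensionality => A.
apply: propositional_extensionality; split=> [[_ [A' cA' ->] ->]|cA].
  suff -> : (fun x => A' (h (f x))) = A' by [].
  by apply: functional_extensionality => x; rewrite fK.
exists (fun y => A (h y)); first by exists A.
by apply: functional_extensionality => x; rewrite fK.
Qed.

Theorem grp_iso_CF (G H : grp) : grp_iso G H -> CF_labelled_iso G H.
Proof.
case=> f [fM [h fK hK]].
have hM x y : h (x ** y) = h x ** h y by rewrite -{1}(hK x) -{1}(hK y) -fM fK.
exists (CF_transport fM fK hK); split.
- by exists (CF_transport hM hK fK); apply: CF_transportK.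
- move=> c d; have [A _ cA] := CF_memP c; have [B _ dB] := CF_memP d.
  have cA' : proj1_sig (CF_transport fM fK hK c) (fun y => A (h y)) by exists A.
  have dB' : proj1_sig (CF_transport fM fK hK d) (fun y => B (h y)) by exists B.
  rewrite (CF_leP cA dB) (CF_leP cA' dB'); split=> [[g gP]|[g gP]].
    by exists (f g) => y /gP; rewrite (gmorphJ hM) fK.
  by exists (h g) => x Ax; move: (gP (f x)); rewrite (gmorphJ hM) fK; apply.
move=> c A cA B [A' cA' ->].
have [k kP] : exists k, forall x, A x <-> A' (gconj x k).
  case: c cA cA' => C [A0 [fA E]] /=; rewrite E => -[a aP] [b bP].
  exists (a ** ginv b) => x; rewrite aP bP -gconjgM gmulKV //.
exists (fun x => f (gconj x k)); split=> [x /kP|x y _ _|x y _ _ E|y Ay].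
- by rewrite fK.
- by rewrite gconjMg fM.
- by apply: (@gconj_inj _ k); rewrite -(fK (gconj x k)) E fK.
- by exists (gconj (h y) (ginv k)); rewrite kP gconjKV hK.
Qed.

(** * Special subgroups and retractions *)

#[local] Arguments gmul : simpl never.
#[local] Arguments gone : simpl never.
#[local] Arguments ginv : simpl never.

Section GraphProductTheory.
Variables (V : finType) (e : rel V) (gT : V -> finGroupType).
Local Notation G := (graph_product e gT).
Local Notation P := {dffun forall v, gT v}.
Local Notation cl w := (@gp_cl V e gT w : gcar G).
Local Notation word := (word gT).
Implicit Types (g h : G) (w : word) (L K : {set V}).

Lemma gp_word g : exists w, g = cl w.
Proof. by exists (gp_rep g); rewrite gp_clK. Qed.

Lemma cl_cat w w' : cl (w ++ w') = cl w ** cl w'.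
Proof. by rewrite -[LHS]gp_mul_cl. Qed.

Lemma cl_cons x w : cl (x :: w) = cl [:: x] ** cl w.
Proof. exact: (cl_cat [:: x]). Qed.

Definition letter_in L (x : letter gT) := projT1 x \in L.

(** Deleting letters turns each defining relation into itself or into a trivial identity. *)
Lemma filter_wrel L w w' :
  wrel e w w' -> wrel e (filter (letter_in L) w) (filter (letter_in L) w').
Proof.
elim=> {w w'}.
- by move=> w; apply: wr_refl.
- by move=> w w' _ /wr_sym.
- by move=> w1 w2 w3 _ H1 _ H2; apply: wr_trans H1 H2.
- by move=> u w w' z _ IH; rewrite !filter_cat; apply: wr_ctx.
- by move=> v; rewrite /letter_in /=; case: ifP => _; [apply: wr_one | apply: wr_refl].
- move=> v a b; rewrite /letter_in /=; case: (v \in L); [apply: wr_mul | apply: wr_refl].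
- move=> v u a b vu; rewrite /letter_in /=.
  by case: (v \in L); case: (u \in L); try apply: wr_refl; apply: wr_comm.
Qed.

Definition rho L g : G := cl (filter (letter_in L) (gp_rep g)).

Lemma rho_cl L w : rho L (cl w) = cl (filter (letter_in L) w).
Proof. apply: gp_cl_eq; apply/filter_wrel/wr_sym/gp_rep_cl. Qed.

Lemma rhoM L g h : rho L (g ** h) = rho L g ** rho L h.
Proof.
have [w ->] := gp_word g; have [w' ->] := gp_word h.
by rewrite -cl_cat !rho_cl filter_cat cl_cat.
Qed.

Lemma rho_rho L K g : rho L (rho K g) = rho (L :&: K) g.
Proof.
have [w ->] := gp_word g; rewrite !rho_cl -filter_predI.
by congr gp_cl; apply: eq_filter => x; rewrite /= /letter_in inE.
Qed.

Lemma rhoK L g : rho L (rho L g) = rho L g.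
Proof. by rewrite rho_rho setIid. Qed.

Lemma rhoT g : rho setT g = g.
Proof.
have [w ->] := gp_word g; rewrite rho_cl; congr gp_cl.
by apply/all_filterP/allP => x _; rewrite /letter_in inE.
Qed.

(** The subgroup generated by the vertex groups over [L], encoded as the fixed points of the
    retraction; [special_word] and [special_cl] relate the two descriptions. *)
Definition special L g : Prop := rho L g = g.

Lemma special_subgroup L : is_subgroup (special L).
Proof.
split=> [|x y|x]; rewrite /special.
- exact: (gmorph1 (rhoM L)).
- by move=> ex ey; rewrite rhoM ex ey.
- by move=> ex; rewrite (gmorphV (rhoM L)) ex.
Qed.

Lemma special_word L g : special L g -> exists2 w, all (letter_in L) w & g = cl w.
Proof.
have [w ->] := gp_word g; rewrite /special rho_cl => E.
by exists (filter (letter_in L) w); rewrite ?filter_all.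
Qed.

Lemma special_cl L w : all (letter_in L) w -> special L (cl w).
Proof. by move=> /all_filterP E; rewrite /special rho_cl E. Qed.

Lemma rho_special L K g : special L g -> special (L :&: K) (rho K g).
Proof. by rewrite /special => E; rewrite rho_rho -setIA setIid -{2}E rho_rho setIC. Qed.

Lemma special_sub L K g : L \subset K -> special L g -> special K g.
Proof. by move=> /setIidPr LK E; rewrite /special -E rho_rho LK. Qed.

(* If [A^g] lies in [G_L] and [A^h] in [G_K], the retraction onto [G_K] fixes
   [A^h] pointwise and conjugates it into the retract of [A^g], which lies in
   the intersection. *)
Lemma sub_conj_specialI (A : G -> Prop) L K :
  sub_conj A (special L) -> sub_conj A (special K) ->
  sub_conj A (special (L :&: K)).
Proof.
case=> g gP [h hP].
exists (h ** ginv (rho K (ginv g ** h))) => a Aa.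
suff -> : gconj a (h ** ginv (rho K (ginv g ** h))) = rho K (gconj a g).
  exact: rho_special (gP a Aa).
rewrite gconjgM -(hP a Aa).
have -> : gconj a h = gconj (gconj a g) (ginv g ** h).
  by rewrite gconjgM gconjK.
by rewrite (gmorphJ (rhoM K)) gconjK.
Qed.

(** * The canonical homomorphism to the direct product of the vertex groups *)

Hypothesis e_irr : irreflexive e.

Definition theta_word w : P := (\prod_(x <- w) dfung1 (projT2 x))%g.

(** Letters that a relation lets commute sit at distinct vertices, by irreflexivity, so their images
    have disjoint supports. *)
Lemma theta_wrel w w' : wrel e w w' -> theta_word w = theta_word w'.
Proof.
rewrite /theta_word; elim=> {w w'} //.
- by move=> w1 w2 w3 _ -> _ ->.
- by move=> u w w' z _ E; rewrite !big_cat /= E.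
- by move=> v; rewrite big_seq1 big_nil /= (morph_one (@dfung1_morphM _ _ v)).
- by move=> v a b; rewrite big_cons !big_seq1 /= dfung1_morphM.
move=> v u a b vu; rewrite !big_cons big_nil /= !mulg1.
apply/ffunP => x; rewrite !dffunM.
have [E|ne] := eqVneq v x; last by rewrite dfung1_dflt // mul1g mulg1.
rewrite [dfung1 b x]dfung1_dflt ?mul1g ?mulg1 //.
by rewrite -E; apply: contraTneq vu => ->; rewrite e_irr.
Qed.

Definition theta g : P := theta_word (gp_rep g).

Lemma theta_cl w : theta (cl w) = theta_word w.
Proof. by apply/theta_wrel/wr_sym/gp_rep_cl. Qed.

Lemma thetaM g h : theta (g ** h) = (theta g * theta h)%g.
Proof.
have [w ->] := gp_word g; have [w' ->] := gp_word h.
by rewrite -cl_cat !theta_cl /theta_word big_cat.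
Qed.

Lemma theta_letter v (a : gT v) : theta (cl [:: existT _ v a]) = dfung1 a.
Proof. by rewrite theta_cl /theta_word big_seq1. Qed.

Lemma theta_one : theta (gone G) = 1%g.
Proof. by rewrite theta_cl /theta_word big_nil. Qed.

Lemma theta_special L g : special L g -> restr L (theta g) = theta g.
Proof.
case/special_word => w wL ->; rewrite theta_cl /theta_word.
elim: w wL => [|x w IH] /=; first by rewrite big_nil (morph_one (restrM L)).
by case/andP => xL wL; rewrite big_cons restrM IH // restr_dfung1.
Qed.

(** For [v] in [L] but not in [K], the retraction onto the vertex group at [v] kills [special K],
    hence every letter at [v]; but [theta] detects a nontrivial one. *)
Lemma special_sub_conj L K : (forall v, nontrivial (gT v)) ->
  sub_conj (special L) (special K) -> L \subset K.
Proof.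
move=> nt [g gP]; apply/subsetP => v vL; apply/negPn/negP => vK.
have [a aN1] : exists a : gT v, a != 1%g.
  case: (pickP (fun a : gT v => a != 1%g)) => [a|none]; first by exists a.
  move: (nt v); rewrite /nontrivial; have -> : [set: gT v] = [set 1%g].
    by apply/setP => a; rewrite !inE; move: (none a) => /negbFE ->.
  by rewrite cards1.
have aL : special L (cl [:: existT _ v a]).
  by apply: special_cl; rewrite /= /letter_in /= vL.
have a1 : rho [set v] (gconj (cl [:: existT _ v a]) g) = gone G.
  rewrite -(gP _ aL) rho_rho; set h := gconj _ g.
  have -> : [set v] :&: K = set0.
    by apply/setP => u; rewrite !inE; case: eqP => [->|] //; rewrite (negbTE vK).
  have [w ->] := gp_word h; rewrite rho_cl.
  rewrite (_ : filter _ w = [::]) //; apply/eqP; rewrite -[_ == _]negbK -has_filter.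
  by apply/hasPn => x _; rewrite /letter_in inE.
move: a1; rewrite (gmorphJ (rhoM _)) => a1.
have {}a1 : rho [set v] (cl [:: existT _ v a]) = gone G.
  by apply: (@gconj_inj _ (rho [set v] g)); rewrite a1 gconj1g.
move: a1; rewrite rho_cl /= /letter_in /= inE eqxx => a1.
case/eqP: aN1; rewrite -(dfung1_id a) -theta_letter.
by rewrite /= in a1 *; rewrite a1 theta_one ffunE.
Qed.

(** * Special subgroups of cliques as direct products *)

Definition clique K := [forall u in K, forall v in K, (u != v) ==> e u v].

Lemma cliqueP K : reflect (forall u v, u \in K -> v \in K -> u != v -> e u v) (clique K).
Proof.
apply: (iffP forall_inP) => [H u v uK vK uv|H u uK].
  by apply: (implyP (forall_inP (H u uK) v vK)).
by apply/forall_inP => v vK; apply/implyP; apply: H.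
Qed.

Lemma clique_sub K L : K \subset L -> clique L -> clique K.
Proof.
move=> /subsetP KL /cliqueP LP; apply/cliqueP => u v /KL uL /KL vL; exact: LP.
Qed.

Lemma cl_one v : cl [:: existT _ v (1%g : gT v)] = gone G.
Proof. by apply: gp_cl_eq; apply: wr_one. Qed.

Lemma cl_mul v (a b : gT v) : cl [:: existT _ v (a * b)%g] =
  cl [:: existT _ v a] ** cl [:: existT _ v b].
Proof. by rewrite -cl_cat; apply: gp_cl_eq; apply/wr_sym/wr_mul. Qed.

Lemma cl_comm u v (a : gT u) (b : gT v) : e u v ->
  cl [:: existT _ u a] ** cl [:: existT _ v b] =
  cl [:: existT _ v b] ** cl [:: existT _ u a].
Proof. by move=> uv; rewrite -!cl_cat; apply: gp_cl_eq; apply: wr_comm. Qed.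

(** Spells out the coordinates of [x] along [s]; when [s] enumerates a clique this is a section of
    [theta] on the subproduct. *)
Definition iota_seq (s : seq V) (x : P) : G := cl [seq existT _ v (x v) | v <- s].

Lemma iota_seq_nil x : iota_seq [::] x = gone G.
Proof. by []. Qed.

Lemma iota_seq_cons v s x :
  iota_seq (v :: s) x = cl [:: existT _ v (x v)] ** iota_seq s x.
Proof. exact: cl_cons. Qed.

Lemma iota_seq_comm v (a : gT v) s x : (forall u, u \in s -> e u v) ->
  iota_seq s x ** cl [:: existT _ v a] = cl [:: existT _ v a] ** iota_seq s x.
Proof.
elim: s => [|u s IH] H; first by rewrite !iota_seq_nil gmul1 gmulr1.
rewrite iota_seq_cons -gmulA IH ?gmulA; last by move=> t ts; apply: H; rewrite inE ts orbT.
by rewrite cl_comm // H // inE eqxx.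
Qed.

Lemma iota_seqM s x y : uniq s ->
  (forall u v, u \in s -> v \in s -> u != v -> e u v) ->
  iota_seq s (x * y)%g = iota_seq s x ** iota_seq s y.
Proof.
elim: s => [|v s IH]; first by move=> _ _; rewrite !iota_seq_nil gmul1.
rewrite [uniq _]/=.
case/andP => vs us H; rewrite !iota_seq_cons ffunE cl_mul IH //; last first.
  by move=> t u ts us'; apply: H; rewrite inE ?ts ?us' orbT.
rewrite -!gmulA; congr (_ ** _); rewrite !gmulA; congr (_ ** _).
rewrite iota_seq_comm // => u uS; apply: H; rewrite ?inE ?uS ?eqxx ?orbT //.
by apply: contraNneq vs => <-.
Qed.

Lemma iota_seq_one s : iota_seq s 1%g = gone G.
Proof.
by elim: s => [|v s IH] //; rewrite iota_seq_cons IH ffunE cl_one gmul1.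
Qed.

Lemma iota_seq_letter s v (a : gT v) : uniq s -> v \in s ->
  iota_seq s (dfung1 a) = cl [:: existT _ v a].
Proof.
have out t : v \notin t -> iota_seq t (dfung1 a) = gone G.
  elim: t => [|u t IH] //; rewrite inE negb_or => /andP[vu vt].
  by rewrite iota_seq_cons IH // dfung1_dflt // cl_one gmul1.
elim: s => [|u s IH] //=; rewrite inE iota_seq_cons => /andP[us uS].
case: eqP => [E _|/eqP vu /= vs].
  by subst u; rewrite dfung1_id out // gmulr1.
by rewrite dfung1_dflt // cl_one gmul1 IH.
Qed.

Definition iota K := iota_seq (enum K).

Lemma iotaM K x y : clique K -> iota K (x * y)%g = iota K x ** iota K y.
Proof.
move=> /cliqueP KP; apply: iota_seqM; first exact: enum_uniq.
by move=> u v; rewrite !mem_enum; apply: KP.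
Qed.

Lemma iota_special K x : special K (iota K x).
Proof.
apply: special_cl; apply/allP => _ /mapP [v vK ->].
by rewrite /letter_in /= -mem_enum.
Qed.

Lemma thetaK K g : clique K -> special K g -> iota K (theta g) = g.
Proof.
move=> cK /special_word [w wK ->]; elim: w wK => [|[v a] w IH] /=.
  by move=> _; rewrite theta_one /iota iota_seq_one.
case/andP => vK wK; rewrite cl_cons thetaM iotaM // IH // theta_letter.
by rewrite /iota iota_seq_letter ?enum_uniq ?mem_enum.
Qed.

Lemma iotaK K x : theta (iota K x) = restr K x.
Proof.
apply/ffunP => u; rewrite [in RHS]ffunE -mem_enum /iota.
elim: (enum K) (enum_uniq K) => [|v s IH].
  by rewrite iota_seq_nil theta_one ffunE.
case/andP => vs /IH {}IH; rewrite iota_seq_cons thetaM theta_letter dffunM IH inE.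
have [->|uv] := eqVneq u v; last by rewrite dfung1_dflt ?mul1g // eq_sym.
by rewrite (negbTE vs) dfung1_id mulg1.
Qed.

Lemma special_clique_finite K : clique K -> is_finite_subgroup (special K).
Proof.
move=> cK; split; first exact: special_subgroup.
exists (List.map (iota K) (enum {: P})) => g gK.
rewrite -(thetaK cK gK); apply: List.in_map.
have : theta g \in enum {: P} by rewrite mem_enum.
elim: (enum _) => [|x s IH] //=; rewrite inE.
by case/orP => [/eqP ->|/IH]; [left | right].
Qed.

End GraphProductTheory.

(** * Finite subgroups of graph products *)

Section Amalgam.
Variables (V : finType) (e : rel V) (gT : V -> finGroupType).
Local Notation G := (graph_product e gT).
Local Notation cl w := (@gp_cl V e gT w : gcar G).
Local Notation rho := (@rho V e gT).
Local Notation special := (@special V e gT).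
Hypothesis e_sym : symmetric e.
Variables v w : V.
Hypotheses (vw : v != w) (evw : ~~ e v w).

(** [side true] contains [v] and [side false] contains [w]; since these are not adjacent, every edge
    lies within one side. *)
Definition side (t : bool) : {set V} := if t then ~: [set w] else ~: [set v].
Definition core : {set V} := side true :&: side false.

Local Notation rhoC := (rho core).
Implicit Types (g a b n : G) (l : seq (bool * G)) (t : bool).

Lemma side_setI t : side t :&: side (~~ t) = core.
Proof. by case: t; rewrite // setIC. Qed.

Lemma core_sub t : core \subset side t.
Proof. by case: t; rewrite ?subsetIl ?subsetIr. Qed.

Lemma special_core t g : special core g -> special (side t) g.
Proof. exact: special_sub (core_sub t). Qed.

Lemma rhoC_side t g : special (side t) (rhoC g).
Proof. by apply: special_core; rewrite /special rhoK. Qed.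

Lemma rhoC_rhoC g : rhoC (rhoC g) = rhoC g.
Proof. exact: rhoK. Qed.

(* The normal closure of [G_w] in [G_(V - v)] (for [t = false]), respectively of
   [G_v] in [G_(V - w)]: the amalgam is their free product extended by the core,
   so its normal forms alternate between their nontrivial elements. *)
Definition factor t n : Prop := special (side t) n /\ rhoC n = gone G.

Definition starts t l : bool := if l is (s, _) :: _ then s == t else false.

Fixpoint normal_form l : Prop :=
  if l is (t, n) :: l' then
    [/\ factor t n, n <> gone G, ~~ starts t l' & normal_form l']
  else True.

(** When [l] does not start on side [t], the head is the trivial element and the tail is all of [l],
    so that [ccons t] always reassembles a normal form. *)
Definition hd t l : G :=
  if l is (s, n) :: _ then if s == t then n else gone G else gone G.

Definition tl t l : seq (bool * G) :=
  if l is (s, _) :: l' then if s == t then l' else l else [::].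

(** Drops a trivial syllable; the test is classical because equality in the graph product is not
    given as decidable. *)
Definition ccons t n l : seq (bool * G) :=
  if excluded_middle_informative (n = gone G) then l else (t, n) :: l.

Definition lconj a l : seq (bool * G) :=
  [seq (p.1, gconj p.2 (ginv a)) | p <- l].

(** Van der Waerden's method: a normal form stands for the coset of its product modulo the core.
    Left multiplication by [a] modifies the head, and [rhoC a] is pushed to the right through the
    tail, conjugating it, until the core absorbs it. *)
Definition act t a l : seq (bool * G) :=
  ccons t (a ** hd t l ** ginv (rhoC a)) (lconj (rhoC a) (tl t l)).

Lemma starts_lconj t a l : starts t (lconj a l) = starts t l.
Proof. by case: l => [|[]]. Qed.

Lemma starts_tl t l : normal_form l -> ~~ starts t (tl t l).
Proof.
case: l => [|[s n] l] //= [_ _ ns _]; case: (eqVneq s t) => [<-|ne] //=.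
Qed.

Lemma normal_form_tl t l : normal_form l -> normal_form (tl t l).
Proof. by case: l => [|[s n] l] //= [? ? ? ?]; case: ifP. Qed.

Lemma factor_hd t l : normal_form l -> factor t (hd t l).
Proof.
have [s1 _ _] := special_subgroup e gT (side t).
have f1 : factor t (gone G) by split; rewrite ?(gmorph1 (@rhoM _ _ _ _)).
by case: l => [|[s n] l] //= [? ? ? ?]; case: eqP => // <-.
Qed.

Lemma factor_conj t a n : special core a -> factor t n -> factor t (gconj n (ginv a)).
Proof.
move=> ca [sn cn]; split; last first.
  by rewrite (gmorphJ (@rhoM _ _ _ _)) cn gconj1g.
have [_ sM sV] := special_subgroup e gT (side t).
rewrite /gconj ginvK; apply: (sM); first exact: special_core.
by apply: (sM) => //; apply/sV/special_core.
Qed.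

Lemma normal_form_lconj a l : special core a -> normal_form l -> normal_form (lconj a l).
Proof.
move=> ca; elim: l => [|[t n] l IH] //= [fn n1 ns nl].
split; [exact: factor_conj | | by rewrite starts_lconj | exact: IH].
by move=> E; apply: n1; apply: (@gconj_inj _ (ginv a)); rewrite E gconj1g.
Qed.

Lemma normal_form_ccons t n l : factor t n -> ~~ starts t l -> normal_form l ->
  normal_form (ccons t n l).
Proof. by move=> fn ns nl; rewrite /ccons; case: excluded_middle_informative. Qed.

Lemma factor_act t a n : special (side t) a -> factor t n ->
  factor t (a ** n ** ginv (rhoC a)).
Proof.
move=> sa [sn cn]; have [_ sM sV] := special_subgroup e gT (side t).
split; first by apply: (sM); [apply: (sM) | apply/sV/rhoC_side].
by rewrite !rhoM cn gmulr1 (gmorphV (@rhoM _ _ _ _)) rhoC_rhoC gmulVr.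
Qed.

Lemma normal_form_act t a l : special (side t) a -> normal_form l ->
  normal_form (act t a l).
Proof.
move=> sa nl; apply: normal_form_ccons.
- by apply: factor_act => //; apply: factor_hd.
- by rewrite starts_lconj starts_tl.
- by apply: normal_form_lconj; [apply: rhoC_rhoC | apply: normal_form_tl].
Qed.

Lemma hd_ccons t n l : ~~ starts t l -> hd t (ccons t n l) = n.
Proof.
rewrite /ccons; case: excluded_middle_informative => [E|_] /=; last by rewrite eqxx.
rewrite E {E}.
by case: l => [|[s m] l] //= /negbTE ->.
Qed.

Lemma tl_ccons t n l : ~~ starts t l -> tl t (ccons t n l) = l.
Proof.
rewrite /ccons; case: excluded_middle_informative => [_|_] /=; last by rewrite eqxx.
by case: l => [|[s m] l] //= /negbTE ->.
Qed.

Lemma ccons_hd_tl t l : normal_form l -> ccons t (hd t l) (tl t l) = l.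
Proof.
rewrite /ccons; case: l => [|[s n] l] //=; first by case: excluded_middle_informative.
by case=> _ n1 _ _; case: eqP => [->|_]; case: excluded_middle_informative.
Qed.

Lemma lconjM a b l : lconj (a ** b) l = lconj a (lconj b l).
Proof.
by rewrite /lconj -map_comp; apply: eq_map => p /=; rewrite ginvM gconjgM.
Qed.

Lemma lconj1 l : lconj (gone G) l = l.
Proof.
rewrite -[RHS]map_id; apply: eq_map => -[t n] /=.
by rewrite ginv1 gconj1.
Qed.

Lemma actM t a b l : special (side t) a -> special (side t) b -> normal_form l ->
  act t (a ** b) l = act t a (act t b l).
Proof.
move=> sa sb nl; rewrite {2 3}/act hd_ccons ?tl_ccons ?starts_lconj ?starts_tl //.
rewrite -lconjM -rhoM /act; congr ccons.
by rewrite rhoM ginvM !gmulA.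
Qed.

Lemma act1 t l : normal_form l -> act t (gone G) l = l.
Proof.
move=> nl; rewrite /act (gmorph1 (@rhoM _ _ _ _)) ginv1 gmul1 gmulr1 lconj1.
exact: ccons_hd_tl.
Qed.

(** The result is independent of [t]: the actions of the two sides agree on the core and therefore
    glue. *)
Lemma act_core t a l : special core a -> normal_form l -> act t a l = lconj a l.
Proof.
move=> ca nl; rewrite /act [rhoC a]ca -{3}(ccons_hd_tl t nl) /ccons.
have -> : a ** hd t l ** ginv a = gconj (hd t l) (ginv a).
  by rewrite /gconj ginvK gmulA.
case: excluded_middle_informative => E1; case: excluded_middle_informative => E2 //.
  by case: E2; apply: (@gconj_inj _ (ginv a)); rewrite E1 gconj1g.
by case: E1; rewrite E2 gconj1g.
Qed.

(** Letters at [v] act through [side true] and all others through [side false]; for letters of the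
    core the choice is immaterial by [lact_side]. *)
Definition lact (x : letter gT) l := act (projT1 x == v) (cl [:: x]) l.
Definition wact (u : word gT) l := foldr lact l u.

Lemma letter_side (x : letter gT) t : projT1 x \in side t -> special (side t) (cl [:: x]).
Proof. by move=> xt; apply: special_cl; rewrite /= /letter_in xt. Qed.

Lemma side_letter (x : letter gT) : special (side (projT1 x == v)) (cl [:: x]).
Proof.
apply: letter_side; case: eqVneq => [->|ne]; rewrite !inE ?ne ?vw //.
Qed.

Lemma lact_side (x : letter gT) t l : projT1 x \in side t -> normal_form l ->
  lact x l = act t (cl [:: x]) l.
Proof.
move=> xt nl; rewrite /lact; have [-> //|ne] := eqVneq (projT1 x == v) t.
have xc : special core (cl [:: x]).
  apply: special_cl; rewrite /= /letter_in andbT -(side_setI t) inE xt /=.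
  move: xt ne; case: t; case: (eqVneq (projT1 x) v) => [->|nv] //=;
    by rewrite !inE ?nv ?vw // eqxx.
by rewrite !act_core.
Qed.

Lemma normal_form_wact u l : normal_form l -> normal_form (wact u l).
Proof.
by move=> nl; elim: u => [|x u IH] //=; apply: normal_form_act => //; apply: side_letter.
Qed.

Lemma wact_wrel u u' : wrel e u u' -> forall l, normal_form l -> wact u l = wact u' l.
Proof.
elim=> {u u'} //.
- by move=> u u' _ IH l nl; rewrite IH.
- by move=> u1 u2 u3 _ IH1 _ IH2 l nl; rewrite IH1 // IH2.
- move=> u x x' z _ IH l nl; rewrite /wact !foldr_cat -!/(wact _ _) IH //.
  exact: normal_form_wact.
- move=> x l nl; rewrite /wact /= /lact cl_one; exact: act1.
- move=> x a b l nl; rewrite /wact /= /lact cl_mul /= actM //; exact: (side_letter (existT _ _ _)).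
move=> x y a b xy l nl; rewrite /wact /=.
(* Non-adjacency of [v] and [w] enters here: both ends of an edge lie in a common side, where [act]
   is an action. *)
have [t xt yt] : exists2 t, x \in side t & y \in side t.
  have [E|nx] := eqVneq x v.
    exists true; rewrite !inE ?E //; apply: contraTneq xy => ->.
    by rewrite E.
  have [E|ny] := eqVneq y v; last by exists false; rewrite !inE.
  exists true; rewrite !inE ?E //; apply: contraTneq xy => ->.
  by rewrite E e_sym.
have nla := normal_form_act (side_letter (existT _ x a)) nl.
have nlb := normal_form_act (side_letter (existT _ y b)) nl.
rewrite (@lact_side (existT _ x a) t) // (@lact_side (existT _ y b) t) //.
rewrite (@lact_side (existT _ y b) t) // (@lact_side (existT _ x a) t) //.
have sa := @letter_side (existT _ x a) t xt; have sb := @letter_side (existT _ y b) t yt.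
by rewrite -!actM // cl_comm.
Qed.

Definition gact g l := wact (gp_rep g) l.

Lemma gact_cl u l : normal_form l -> gact (cl u) l = wact u l.
Proof. by move=> nl; apply: wact_wrel => //; apply/wr_sym/gp_rep_cl. Qed.

Lemma normal_form_gact g l : normal_form l -> normal_form (gact g l).
Proof. exact: normal_form_wact. Qed.

Lemma gactM g h l : normal_form l -> gact (g ** h) l = gact g (gact h l).
Proof.
move=> nl; have [u ->] := gp_word g; have [u' ->] := gp_word h.
rewrite -cl_cat !gact_cl //; last exact: normal_form_wact.
by rewrite /wact foldr_cat.
Qed.

Lemma gact1 l : normal_form l -> gact (gone G) l = l.
Proof. by move=> nl; rewrite gact_cl. Qed.

Lemma gact_side t a l : special (side t) a -> normal_form l -> gact a l = act t a l.
Proof.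
case/special_word => u uP -> nl; rewrite gact_cl //.
elim: u uP => [|x u IH] /=; first by rewrite act1.
case/andP => xt ut; rewrite IH // (@lact_side x t) //; last first.
  by apply: normal_form_act => //; apply: special_cl.
by rewrite (cl_cons _ x u) actM //; [apply: letter_side | apply: special_cl].
Qed.

Definition lprod l : G := foldr (fun p g => p.2 ** g) (gone G) l.

Lemma lprod_lconj a l : lprod (lconj a l) = gconj (lprod l) (ginv a).
Proof. by elim: l => [|p l IH] /=; rewrite ?gconj1g // gconjMg IH. Qed.

Lemma lprod_ccons t n l : lprod (ccons t n l) = n ** lprod l.
Proof.
by rewrite /ccons; case: excluded_middle_informative => [E|_] //=; rewrite E gmul1.
Qed.

Lemma lprod_act t a l : normal_form l -> lprod (act t a l) = a ** lprod l ** ginv (rhoC a).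
Proof.
move=> nl; rewrite /act lprod_ccons lprod_lconj -{3}(ccons_hd_tl t nl) lprod_ccons.
by rewrite /gconj ginvK !gmulA gmulKV.
Qed.

Lemma lprod_gact g l : normal_form l -> lprod (gact g l) = g ** lprod l ** ginv (rhoC g).
Proof.
have [u ->] := gp_word g => nl; rewrite gact_cl //.
elim: u => [|x u IH] /=; first by rewrite (gmorph1 (@rhoM _ _ _ _)) ginv1 gmul1 gmulr1.
rewrite lprod_act; [rewrite IH | exact: normal_form_wact].
by rewrite (cl_cons _ x u) rhoM ginvM !gmulA.
Qed.

(** The orbit of the base coset. The length of [nf g] is the distance, in steps between adjacent
    edges, from the base edge of the Bass-Serre tree to its translate by [g]. *)
Definition nf g := gact g [::].

Lemma normal_form_nf g : normal_form (nf g).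
Proof. exact: normal_form_gact. Qed.

Lemma nfK g : g = lprod (nf g) ** rhoC g.
Proof. by rewrite lprod_gact // gmulr1 gmulKV. Qed.

Lemma nfM g h : nf (g ** h) = gact g (nf h).
Proof. exact: gactM. Qed.

(** Such a [g] is at most one syllable times an element of the core: the translated edge shares an
    endpoint with the base edge. *)
Lemma nf_side g : size (nf g) <= 1 ->
  special (side false) g \/ special (side true) g.
Proof.
have [t st] : exists t, size (nf g) <= 1 -> special (side t) (lprod (nf g)).
  move: (normal_form_nf g); case: (nf g) => [|[t n] [|p l]] //= nl.
  - by exists true; have [] := special_subgroup e gT (side true).
  - by exists t => _; rewrite gmulr1; case: nl => [[]].
  - by exists true.
have [_ sM _] := special_subgroup e gT (side t).
move=> /st {}st; suff : special (side t) g by case: (t); auto.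
by rewrite [g in special _ g]nfK; apply: (sM) => //; apply: rhoC_side.
Qed.

Definition same_start l l' : bool :=
  if l is (t, _) :: _ then starts t l' else false.

Lemma factorV t n : factor t n -> factor t (ginv n).
Proof.
case=> sn cn; have [_ _ sV] := special_subgroup e gT (side t).
by split; [apply: sV | rewrite (gmorphV (@rhoM _ _ _ _)) cn ginv1].
Qed.

Lemma gact_factor t n l : factor t n -> normal_form l ->
  gact n l = ccons t (n ** hd t l) (tl t l).
Proof.
case=> sn cn nl; rewrite (gact_side sn) // /act cn ginv1 gmulr1.
by rewrite lconj1.
Qed.

Lemma hd_tl_not_starts t l : ~~ starts t l -> hd t l = gone G /\ tl t l = l.
Proof. by case: l => [|[s n] l] //= /negbTE ->. Qed.

(** No cancellation: the inverted syllables of [r] are put in front of [l] one by one, each on the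
    side opposite to the syllable it meets. *)
Lemma size_gact_lprodV r l : normal_form r -> normal_form l -> ~~ same_start r l ->
  size (gact (ginv (lprod r)) l) = size r + size l.
Proof.
elim: r l => [|[t n] r IH] l /=; first by move=> _ nl _; rewrite ginv1 gact1.
case=> fn n1 ns nr nl nsl.
have [hdl tll] := hd_tl_not_starts nsl.
have E : gact (ginv n) l = (t, ginv n) :: l.
  rewrite (gact_factor (factorV fn)) // hdl tll gmulr1 /ccons.
  by case: excluded_middle_informative => // n1'; case: n1; rewrite -(ginvK n) n1' ginv1.
have nf' := normal_form_gact (ginv n) nl.
rewrite ginvM gactM // IH //; first by rewrite E addnS.
by rewrite E; case: r ns {IH nr} => [|[s m] r] //=; rewrite eq_sym.
Qed.

(* Strict convexity of the distance to [p] in the Bass-Serre tree, along the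
   first step of the geodesic from the base edge to its translate by [q]. *)
Lemma nf_convex q t n l : nf q = (t, n) :: l -> 0 < size l -> forall p,
  size (nf (ginv n ** p)) < size (nf p) \/
  size (nf (ginv n ** p)) < size (nf (ginv q ** p)).
Proof.
move=> nfq l0 p; have /= [fn n1 ns nl] : normal_form ((t, n) :: l).
  by rewrite -nfq; apply: normal_form_nf.
have np := normal_form_nf p.
set m := nf (ginv n ** p).
have Em : m = ccons t (ginv n ** hd t (nf p)) (tl t (nf p)).
  by rewrite /m nfM (gact_factor (factorV fn)).
(* Either [n] is the first syllable of [p] and cancels, which shortens the form, or [m] starts on
   side [t]. In that case [l] starts on the other side, so passing from [m] to the form of
   [ginv q ** p] adds [size l] syllables. *)
case: (excluded_middle_informative (ginv n ** hd t (nf p) = gone G)) => [E|NE].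
  left; rewrite Em /ccons; case: excluded_middle_informative => //= _.
  have {}E : hd t (nf p) = n by apply: (@gmul_injl _ (ginv n)); rewrite E gmulV.
  move: E; case: (nf p) => [|[s k] l'] /=; first by move=> /esym.
  by case: eqP => // _ /esym.
right; have Eq : ginv q ** p = ginv (rhoC q) ** (ginv (lprod l) ** (ginv n ** p)).
  rewrite [q in ginv q]nfK nfq /= !ginvM !gmulA //.
rewrite Eq nfM [nf (ginv (lprod l) ** _)]nfM -/m.
have nm : normal_form m by apply: normal_form_nf.
have cC : special core (ginv (rhoC q)).
  have [_ _ sV] := special_subgroup e gT core; apply: sV; exact: rhoC_rhoC.
rewrite (gact_side (special_core true cC)); last exact: normal_form_gact.
rewrite act_core //; last exact: normal_form_gact.
rewrite size_map size_gact_lprodV //; first by rewrite -[X in X < _]add0n ltn_add2r.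
rewrite Em /ccons; case: excluded_middle_informative => //= _.
by case: l ns {nfq l0 nl Eq} => [|[s k] l] //=; rewrite eq_sym.
Qed.

(* Minimise over [g] the radius of a ball around [g] that contains [F]: by strict
   convexity the translates of a minimal centre by [F] are adjacent to it. *)
Theorem finite_subgroup_amalgam (F : G -> Prop) : is_finite_subgroup F ->
  sub_conj F (special (side false)) \/ sub_conj F (special (side true)).
Proof.
case=> sF [s sP]; have [F1 FM FV] := sF.
pose bounded g m := forall f, F f -> size (nf (ginv g ** f)) <= m.
have [m0 bm0] : exists m, bounded (gone G) m.
  suff [m mP] : exists m, forall f, List.In f s -> size (nf (ginv (gone G) ** f)) <= m.
    by exists m => f /sP /mP.
  elim: s {sP} => [|f s [m IH]]; first by exists 0.
  exists (maxn (size (nf (ginv (gone G) ** f))) m) => f' /= [<-|/IH H].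
    exact: leq_maxl.
  exact: leq_trans H (leq_maxr _ _).
have [g [m [bg min]]] : exists g m, bounded g m /\ forall g' k, bounded g' k -> m <= k.
  elim/ltn_ind: m0 (gone G) bm0 => m IH g bg.
  case: (excluded_middle_informative (exists g' k, bounded g' k /\ k < m)).
    by case=> g' [k [bk km]]; apply: (IH k km g').
  move=> none; exists g, m; split=> // g' k bk; rewrite leqNgt; apply/negP => km.
  by apply: none; exists g', k.
have adj f : F f -> size (nf (gconj f g)) <= 1.
  move=> Ff; rewrite leqNgt; apply/negP => big.
  case E: (nf (gconj f g)) big => [|[t n] l] //=; rewrite ltnS => l0.
  (* Convexity compares [g ** n] with the centres [g] and [f ** g]; the distance from the latter to
     [f'] is that from [g] to [ginv f ** f'], with [ginv f ** f'] again in [F]. *)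
  have key f' : F f' -> size (nf (ginv n ** (ginv g ** f'))) < m.
    move=> Ff'; have [H|H] := nf_convex E l0 (ginv g ** f'); apply: leq_trans H _.
      exact: bg.
    have -> : ginv (gconj f g) ** (ginv g ** f') = ginv g ** (ginv f ** f').
      by rewrite /gconj !ginvM ginvK !gmulA gmulK.
    by apply: bg; apply: FM => //; apply: FV.
  (* [F] contains the identity, so [m] is positive and [m.-1] is a strictly better radius. *)
  have m_gt0 : 0 < m := leq_ltn_trans (leq0n _) (key _ F1).
  have : bounded (g ** n) m.-1.
    by move=> f' Ff'; rewrite -ltnS prednK // ginvM -gmulA; apply: key.
  by move/min; rewrite leqNgt ltn_predL m_gt0.
(* The conjugate of [F] is covered by the two sides, hence contained in one of them. *)
have sub := @is_subgroup_conj _ _ (ginv g) sF.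
case: (subgroup_union sub (special_subgroup e gT (side false))
    (special_subgroup e gT (side true))).
- by move=> x /adj; rewrite gconjKV => /nf_side.
- by move=> H; left; exists g => x Fx; apply: H; rewrite gconjK.
- by move=> H; right; exists g => x Fx; apply: H; rewrite gconjK.
Qed.

End Amalgam.

(** Starting from all vertices, a set [L] with [F] conjugate into [special L] loses one of two
    non-adjacent vertices by the amalgam theorem and [sub_conj_specialI], until it is a clique. *)
Theorem finite_subgroup_clique (V : finType) (e : rel V) (gT : V -> finGroupType)
    (F : graph_product e gT -> Prop) : symmetric e -> is_finite_subgroup F ->
  exists2 K, maxset (clique e) K & sub_conj F (special (e := e) (gT := gT) K).
Proof.
move=> e_sym fF.
suff [K cK FK] : exists2 K, clique e K & sub_conj F (special (e := e) (gT := gT) K).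
  have [M maxM KM] := maxset_exists cK; exists M => //.
  case: FK => g gP; exists g => x /gP; exact: special_sub KM.
have : sub_conj F (special (e := e) (gT := gT) setT).
  by exists (gone _) => x _; apply: rhoT.
move En : #|[set: V]| => n; move: [set: V] En => L.
elim/ltn_ind: n L => n IH L En FL.
case: (boolP (clique e L)) => [cL|]; first by exists L.
case/forall_inPn => v vL /forall_inPn [w wL]; rewrite negb_imply => /andP[vw evw].
have step u : u \in L -> sub_conj F (special (e := e) (gT := gT) (~: [set u])) ->
    exists2 K, clique e K & sub_conj F (special (e := e) (gT := gT) K).
  move=> uL /(sub_conj_specialI FL); rewrite -setDE => FLu.
  apply: (IH #|L :\ u| _ (L :\ u)) => //.
  by rewrite -En [X in _ < X](cardsD1 u) uL.
by case: (finite_subgroup_amalgam e_sym vw evw fF) => [/(step v vL)|/(step w wL)].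
Qed.

(** * Recovering the labelled graph *)

Section GraphIso.
Variables (V1 V2 : finType) (e1 : rel V1) (e2 : rel V2).
Variables (gT1 : V1 -> finGroupType) (gT2 : V2 -> finGroupType).

Lemma wrel_map (m : letter gT1 -> letter gT2) w w' :
  (forall v, wrel e2 [:: m (existT _ v (1%g : gT1 v))] [::]) ->
  (forall v (a b : gT1 v), wrel e2 [:: m (existT _ v a); m (existT _ v b)]
     [:: m (existT _ v (a * b)%g)]) ->
  (forall u v (a : gT1 u) (b : gT1 v), e1 u v ->
     wrel e2 [:: m (existT _ u a); m (existT _ v b)]
       [:: m (existT _ v b); m (existT _ u a)]) ->
  wrel e1 w w' -> wrel e2 (map m w) (map m w').
Proof.
move=> m1 mM mC; elim=> {w w'} //=.
- by move=> w; apply: wr_refl.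
- by move=> w w' _ /wr_sym.
- by move=> w1 w2 w3 _ H1 _ H2; apply: wr_trans H1 H2.
- by move=> u w w' z _ IH; rewrite !map_cat; apply: wr_ctx.
Qed.

End GraphIso.

Theorem labelled_graph_iso_grp_iso (V1 V2 : finType) (e1 : rel V1) (e2 : rel V2)
    (gT1 : V1 -> finGroupType) (gT2 : V2 -> finGroupType) :
  labelled_graph_iso e1 e2 gT1 gT2 ->
  grp_iso (graph_product e1 gT1) (graph_product e2 gT2).
Proof.
case=> sigma [[tau sK tK] edge isoV].
have [f fP] : exists f : forall v, gT1 v -> gT2 (sigma v), forall v,
    {morph f v : x y / (x * y)%g} /\ bijective (f v).
  apply: (@fin_all_exists V1 (fun v => gT1 v -> gT2 (sigma v))
    (fun v f => {morph f : x y / (x * y)%g} /\ bijective f)) => v.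
  have /isogP [f finj fim] := isoV v.
  exists f; split; first by move=> x y; rewrite morphM ?inE.
  have inj : injective f by move=> x y; apply: (injmP finj); rewrite inE.
  apply: inj_card_bij => //.
  by rewrite -!cardsT -fim morphimEdom card_imset.
pose m (x : letter gT1) : letter gT2 := existT _ (sigma (projT1 x)) (f _ (projT2 x)).
(* Writing each vertex of the second graph as [sigma u] and substituting avoids casts along
   [sigma (tau v) = v]. *)
have lift v : exists2 u, sigma u = v &
    forall b : gT2 v, exists a : gT1 u, existT gT2 v b = m (existT _ u a).
  exists (tau v) => //; move: (tau v) (tK v) => u <- b.
  by have [_ [h _ hK]] := fP u; exists (h b); rewrite /m /= hK.
have [m' m'K] : exists m' : letter gT2 -> letter gT1, cancel m' m.
  apply: (exists_choice (R := fun y x => m x = y)) => -[v b].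
  by have [u _ /(_ b) [a E]] := lift v; exists (existT _ u a).
have m_inj : injective m.
  move=> [u a] [u' a']; rewrite /m /= => E.
  have Eu : u = u' by apply: (can_inj sK); apply: (congr1 (@projT1 _ _) E).
  subst u'; congr existT; have [_ /bij_inj] := fP u; apply.
  by move/eqP: E; rewrite eq_Tagged /= => /eqP.
have mK : cancel m m' by move=> x; apply: m_inj; rewrite m'K.
have m1 v : m (existT _ v (1%g : gT1 v)) =
    existT _ (sigma v) (1%g : gT2 (sigma v)).
  by rewrite /m /= (morph_one (fP v).1).
have mM v (a b : gT1 v) : m (existT _ v (a * b)%g) =
    existT _ (sigma v) (f v a * f v b)%g by rewrite /m /= (fP v).1.
have m_wrel w w' : wrel e1 w w' -> wrel e2 (map m w) (map m w').
  apply: wrel_map => [v|v a b|u v a b uv]; first by rewrite m1; apply: wr_one.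
    by rewrite mM; apply: wr_mul.
  by apply: wr_comm; rewrite -edge.
have m'_wrel w w' : wrel e2 w w' -> wrel e1 (map m' w) (map m' w').
  apply: wrel_map => [v|v a b|u v a b uv].
  - have [u Eu _] := lift v; subst v; rewrite -m1 mK; exact: wr_one.
  - have [u Eu H] := lift v; subst v; have [a' Ea] := H a; have [b' Eb] := H b.
    have Ea' : a = f u a' by move/eqP: Ea; rewrite /m eq_Tagged /= => /eqP.
    have Eb' : b = f u b' by move/eqP: Eb; rewrite /m eq_Tagged /= => /eqP.
    rewrite Ea Eb Ea' Eb' -mM !mK; exact: wr_mul.
  - have [u' Eu H] := lift u; have [v' Ev K] := lift v; subst u v.
    have [a' ->] := H a; have [b' ->] := K b; rewrite !mK; apply: wr_comm.
    by rewrite edge.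
exists (fun P => gp_cl e2 (map m (gp_rep P))); split=> [x y|].
  rewrite -[RHS]cl_cat -map_cat; apply: gp_cl_eq; apply: m_wrel.
  exact/wr_sym/gp_rep_cl.
exists (fun P => gp_cl e1 (map m' (gp_rep P))) => x.
  rewrite -[RHS]gp_clK; apply: gp_cl_eq.
  rewrite -[X in wrel _ _ X](mapK mK); apply: m'_wrel; exact/wr_sym/gp_rep_cl.
rewrite -[RHS]gp_clK; apply: gp_cl_eq.
rewrite -[X in wrel _ _ X](mapK m'K); apply: m_wrel; exact/wr_sym/gp_rep_cl.
Qed.

(** [iota] and [theta] identify special subgroups of cliques with subproducts; the embedding is
    carried across. *)
Lemma embeds_prod_embed (V1 V2 : finType) (e1 : rel V1) (e2 : rel V2)
    (gT1 : V1 -> finGroupType) (gT2 : V2 -> finGroupType) (I : {set V1}) (J : {set V2}) :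
  irreflexive e1 -> irreflexive e2 -> clique e1 I -> clique e2 J ->
  embeds (special (e := e1) (gT := gT1) I) (special (e := e2) (gT := gT2) J) ->
  prod_embed gT1 gT2 I J.
Proof.
move=> irr1 irr2 cI cJ [f [fJ fM fI]].
have sI := iota_special e1 I; have [s1 _ _] := special_subgroup e1 gT1 I.
have f1 : f (gone _) = gone _.
  by apply: (@gmul_injl _ (f (gone _))); rewrite -fM // gmul1 gmulr1.
exists (fun x => theta (f (iota e1 I x))); split=> [x y|x|x xI].
- by rewrite iotaM // fM // thetaM.
- by rewrite theta_special //; apply: fJ.
move=> E; have : f (iota e1 I x) = f (gone _).
  by rewrite f1 -(thetaK irr2 cJ (fJ _ (sI _ x))) E /iota iota_seq_one.
move/(fI _ _ (sI _ x) s1) => E1.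
by rewrite -xI -(iotaK irr1) E1 theta_one.
Qed.

(** The elements of each fibre are matched by their position in an enumeration. *)
Lemma eq_fibre_bijection (V W C : finType) (f : V -> C) (g : W -> C) :
  (forall c, #|[set v | f v == c]| = #|[set w | g w == c]|) ->
  exists2 s : V -> W, bijective s & forall v, g (s v) = f v.
Proof.
move=> fg.
have [s [s_inj sP]] : exists s : V -> W, injective s /\ forall v, g (s v) = f v.
  pose A c := enum [set v | f v == c]; pose B c := enum [set w | g w == c].
  have AB c : size (A c) = size (B c) by rewrite -!cardE fg.
  have vA v : v \in A (f v) by rewrite mem_enum inE.
  have lt v : index v (A (f v)) < size (B (f v)) by rewrite -AB index_mem.
  (* The default for [nth] depends on [v], since [W] is only known to be inhabited once a [v] is
     given. *)
  have [w0 _] : exists w0 : V -> W, forall v : V, True.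
    apply: (@fin_all_exists V (fun=> W) (fun _ _ => True)) => v.
    by move: (lt v); case: (B _) => // w; exists w.
  pose s v := nth (w0 v) (B (f v)) (index v (A (f v))).
  have sP v : g (s v) = f v.
    by have := mem_nth (w0 v) (lt v); rewrite mem_enum inE => /eqP.
  exists s; split=> // v v' E.
  have Ef : f v = f v' by rewrite -!sP E.
  move: E; rewrite /s (set_nth_default (w0 v')) // Ef => /eqP.
  rewrite nth_uniq ?enum_uniq // -?Ef // => /eqP.
  by apply: index_inj; rewrite ?Ef // -?Ef.
exists s => //; apply: inj_card_bij => //.
rewrite -!sum1_card (partition_big g predT) // [X in _ <= X](partition_big f predT) //.
by apply: leq_sum => c _; rewrite !sum1dep_card fg.
Qed.

(** Inclusion-exclusion by descending induction on [S]: the vertices whose set contains [S] are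
    those with set [S] and those whose set properly contains it. *)
Lemma exact_count (V W I : finType) (f : V -> {set I}) (g : W -> {set I})
    (P : pred V) (Q : pred W) :
  (forall S : {set I}, S != set0 ->
     #|[set v | P v & S \subset f v]| = #|[set w | Q w & S \subset g w]|) ->
  forall S : {set I}, S != set0 ->
     #|[set v | P v & f v == S]| = #|[set w | Q w & g w == S]|.
Proof.
move=> cum S; move En : (#|I| - #|S|) => n.
elim/ltn_ind: n S En => n IH S En S0.
have split_card (X : finType) (h : X -> {set I}) (R : pred X) :
    #|[set x | R x & S \subset h x]| =
    #|[set x | R x & h x == S]| +
    \sum_(S' : {set I} | S \proper S') #|[set x | R x & h x == S']|.
  rewrite -sum1dep_card (partition_big h (fun S' => S \subset S')) /=; last first.
    by move=> x /andP[].
  rewrite (bigD1 S) //=; congr (_ + _).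
    rewrite sum1dep_card; apply: eq_card => x; rewrite !inE.
    by case: eqP => [->|_]; rewrite ?subxx ?andbT ?andbF.
  apply: eq_big => [S'|S' /andP[SS' _]].
    by rewrite properEneq eq_sym andbC.
  rewrite sum1dep_card; apply: eq_card => x; rewrite !inE.
  by case: eqP => [->|_]; rewrite ?SS' ?andbT ?andbF.
have := cum S S0; rewrite !split_card => /eqP.
rewrite (eq_bigr (fun S' => #|[set w | Q w & g w == S']|)).
  by rewrite eqn_add2r => /eqP.
move=> S' SS'; apply: (IH (#|I| - #|S'|)) => //.
  have lt := proper_card SS'; have le := max_card (mem S').
  by rewrite -En; apply: ltn_sub2l => //; apply: leq_trans lt le.
apply: contraTneq SS' => ->; by rewrite properE sub0set subset0 (negbTE S0) andbF.
Qed.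

(** * Maximal cliques under an order isomorphism *)

Section CliqueCorrespondence.
Variables (V1 V2 : finType) (e1 : rel V1) (e2 : rel V2).
Variables (gT1 : V1 -> finGroupType) (gT2 : V2 -> finGroupType).
Local Notation G1 := (graph_product e1 gT1).
Local Notation G2 := (graph_product e2 gT2).
Local Notation sp1 := (special (e := e1) (gT := gT1)).
Local Notation sp2 := (special (e := e2) (gT := gT2)).
Hypotheses (s1 : simple_graph e1) (s2 : simple_graph e2).
Variable psi : CF G1 -> CF G2.
Hypothesis psi_le : forall c d, CF_le c d -> CF_le (psi c) (psi d).

(** Quantifying over all classes that contain the special subgroups keeps finiteness proofs out of
    the definition. *)
Definition corresponding (K : {set V1}) (K' : {set V2}) : Prop :=
  forall c c', proj1_sig c (sp1 K) -> proj1_sig c' (sp2 K') ->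
    CF_le (psi c) c' /\ CF_le c' (psi c).

Lemma corresponding_maxclique (psi' : CF G2 -> CF G1) K :
  (forall v, nontrivial (gT1 v)) -> cancel psi psi' -> cancel psi' psi ->
  (forall c d, CF_le c d -> CF_le (psi' c) (psi' d)) ->
  maxset (clique e1) K ->
  exists2 K', maxset (clique e2) K' & corresponding K K'.
Proof.
move=> nt psiK psiK' psi'_le maxK.
have [irr1 sym1] := s1; have [irr2 sym2] := s2.
pose c0 := CF_class (special_clique_finite gT1 irr1 (maxsetp maxK)).
have c0K : proj1_sig c0 (sp1 K) := CF_class_mem _.
have [B fB cB] := CF_memP (psi c0).
have [K' maxK' BK'] := finite_subgroup_clique sym2 fB; exists K' => // c c' cK c'K'.
have le0 : CF_le c c0 by apply/(CF_leP cK c0K); exists (gone _) => x; rewrite gconj1.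
have cc' : CF_le (psi c) c'.
  by apply: CF_le_trans (psi_le le0) _; apply/(CF_leP cB c'K').
split=> //.
(* Pulled back, [c'] lies above [c] and below the class of a maximal clique [K'']; then [K] is
   contained in [K''], and maximality gives equality. *)
have [A fA c'A] := CF_memP (psi' c').
have [K'' maxK'' AK''] := finite_subgroup_clique sym1 fA.
have KA : sub_conj (sp1 K) A.
  by apply/(CF_leP cK c'A); rewrite -(psiK c); apply: psi'_le.
have KK'' := special_sub_conj irr1 nt (sub_conj_trans KA AK'').
have E := maxsetsup maxK (maxsetp maxK'') KK''; rewrite E in AK''.
by rewrite -(psiK' c'); apply: psi_le; apply/(CF_leP c'A cK).
Qed.

(** The image under [psi] of the class of the intersection lies below every class of [sp2 (F2 t)],
    so a representative is conjugate into the special subgroup of the intersection. *)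
Lemma corresponding_embeds (T : finType) (S : {set T}) (F1 : T -> {set V1})
    (F2 : T -> {set V2}) :
  (forall c A, proj1_sig c A -> forall B, proj1_sig (psi c) B -> embeds A B) ->
  clique e1 (\bigcap_(t in S) F1 t) ->
  (forall t, t \in S ->
     [/\ clique e1 (F1 t), clique e2 (F2 t) & corresponding (F1 t) (F2 t)]) ->
  embeds (sp1 (\bigcap_(t in S) F1 t)) (sp2 (\bigcap_(t in S) F2 t)).
Proof.
move=> psi_embeds cI FP; have [irr1 _] := s1; have [irr2 _] := s2.
pose c := CF_class (special_clique_finite gT1 irr1 cI).
have cm : proj1_sig c _ := CF_class_mem _.
have [B fB cB] := CF_memP (psi c).
apply: embeds_trans (psi_embeds _ _ cm _ cB) _; apply: embeds_sub_conj.
apply: (big_ind (fun L => sub_conj B (sp2 L))).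
- by exists (gone _) => x _; apply: rhoT.
- by move=> L K; apply: sub_conj_specialI.
move=> t tS; have [c1 c2 corr] := FP t tS.
pose d1 := CF_class (special_clique_finite gT1 irr1 c1).
pose d2 := CF_class (special_clique_finite gT2 irr2 c2).
have m1 : proj1_sig d1 _ := CF_class_mem _.
have m2 : proj1_sig d2 _ := CF_class_mem _.
apply/(CF_leP cB m2); apply: CF_le_trans (proj1 (corr _ _ m1 m2)).
apply: psi_le; apply/(CF_leP cm m1); exists (gone _) => x.
by rewrite gconj1; apply: special_sub; apply: bigcap_inf.
Qed.

End CliqueCorrespondence.

Section TypedBijection.
Variables (V1 V2 : finType) (gT1 : V1 -> finGroupType) (gT2 : V2 -> finGroupType).

Let sumT (x : V1 + V2) : finGroupType :=
  match x with inl v => gT1 v | inr w => gT2 w end.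

(** A canonical representative of the isomorphism type among the vertices of both graphs, so that
    types can be compared by equality in a finite type. *)
Let type_of (T : finGroupType) : option (V1 + V2) :=
  [pick x | [set: sumT x] \isog [set: T]].

Lemma type_ofP (x y : V1 + V2) :
  (type_of (sumT x) == type_of (sumT y)) = ([set: sumT x] \isog [set: sumT y]).
Proof.
apply/eqP/idP => [|xy]; last first.
  apply: eq_pick => z; apply/idP/idP => H; first exact: isog_trans xy.
  by apply: isog_trans H _; rewrite isog_sym.
rewrite /type_of; case: pickP => [a ax|/(_ x)]; last by rewrite isog_refl.
case: pickP => // b bY [ab]; rewrite -{b}ab in bY.
by apply: isog_trans bY; rewrite isog_sym.
Qed.

Lemma typed_bijection (I : finType) (f1 : V1 -> {set I}) (f2 : V2 -> {set I}) :
  (forall v, f1 v != set0) -> (forall w, f2 w != set0) ->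
  (forall (S : {set I}) (kT : finGroupType), S != set0 ->
     #|[set v | [set: gT1 v] \isog [set: kT] & S \subset f1 v]| =
     #|[set w | [set: gT2 w] \isog [set: kT] & S \subset f2 w]|) ->
  exists s : V1 -> V2, [/\ bijective s, forall v, f2 (s v) = f1 v
    & forall v, [set: gT1 v] \isog [set: gT2 (s v)]].
Proof.
move=> f1n f2n cum.
have [s bs sP] : exists2 s : V1 -> V2, bijective s &
    forall v, (f2 (s v), type_of (gT2 (s v))) = (f1 v, type_of (gT1 v)).
  apply: (@eq_fibre_bijection _ _ _ (fun v => (f1 v, type_of (gT1 v)))
    (fun w => (f2 w, type_of (gT2 w)))) => -[S r].
  (* Both fibres are empty over the empty set and over a value [r] that no vertex realises;
     [exact_count] treats the rest. *)
  have [S0|S0] := eqVneq S set0.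
    by rewrite !eq_card0 // => x; rewrite !inE xpair_eqE S0 ?(negbTE (f1n _)) ?(negbTE (f2n _)).
  case: (pickP (fun x => type_of (sumT x) == r)) => [x /eqP xr|none]; last first.
    rewrite !eq_card0 // => v; rewrite !inE xpair_eqE andbC.
      by have /= -> := none (inr v).
    by have /= -> := none (inl v).
  have := exact_count (fun S => cum S (sumT x)) S0.
  have -> : [set v | [set: gT1 v] \isog [set: sumT x] & f1 v == S] =
      [set v | (f1 v, type_of (gT1 v)) == (S, r)].
    by apply/setP => v; rewrite !inE xpair_eqE -xr -(type_ofP (inl v)) andbC.
  have -> : [set w | [set: gT2 w] \isog [set: sumT x] & f2 w == S] =
      [set w | (f2 w, type_of (gT2 w)) == (S, r)].
    by apply/setP => w; rewrite !inE xpair_eqE -xr -(type_ofP (inr w)) andbC.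
  by [].
exists s; split=> // v; first by have [] := sP v.
by rewrite -(type_ofP (inl v) (inr (s v))) /=; have [_ ->] := sP v.
Qed.

End TypedBijection.

Lemma maxclique_cover (V : finType) (e : rel V) (K : {set V}) : clique e K ->
  exists2 M, maxset (clique e) M & K \subset M.
Proof. by case/maxset_exists => M; exists M. Qed.

(* A vertex is remembered, up to isomorphism, by the set of maximal cliques that
   contain it, and two distinct vertices are adjacent iff these sets meet. *)
Theorem CF_iso_labelled_graph_iso (V1 V2 : finType) (e1 : rel V1) (e2 : rel V2)
    (gT1 : V1 -> finGroupType) (gT2 : V2 -> finGroupType) :
  simple_graph e1 -> simple_graph e2 ->
  (forall v, nontrivial (gT1 v) /\ directly_indecomposable (gT1 v)) ->
  (forall v, nontrivial (gT2 v) /\ directly_indecomposable (gT2 v)) ->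
  CF_labelled_iso (graph_product e1 gT1) (graph_product e2 gT2) ->
  labelled_graph_iso e1 e2 gT1 gT2.
Proof.
move=> s1 s2 P1 P2 [psi [[psi' psiK psiK'] psi_le psi_iso]].
have [irr1 sym1] := s1; have [irr2 sym2] := s2.
have le1 c d : CF_le c d -> CF_le (psi c) (psi d) by move/psi_le.
have le2 c d : CF_le c d -> CF_le (psi' c) (psi' d).
  by move=> cd; apply/psi_le; rewrite !psiK'.
have emb1 c A : proj1_sig c A -> forall B, proj1_sig (psi c) B -> embeds A B.
  by move=> cA B cB; apply: subgroup_iso_embeds; apply: psi_iso cA _ cB.
have emb2 c A : proj1_sig c A -> forall B, proj1_sig (psi' c) B -> embeds A B.
  move=> cA B cB; apply: subgroup_iso_embeds_inv (psi_iso _ _ cB _ _).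
    by have [] := CF_mem_finite cB.
  by rewrite psiK'.
have nt1 v : nontrivial (gT1 v) by case: (P1 v).
have nt2 v : nontrivial (gT2 v) by case: (P2 v).
(* [tau] is total, with an arbitrary value off the maximal cliques. *)
have [tau tauP] : exists tau : {set V1} -> {set V2}, forall K,
    maxset (clique e1) K -> maxset (clique e2) (tau K) /\ corresponding psi K (tau K).
  apply: (@fin_all_exists {set V1} (fun=> {set V2}) (fun K K' => maxset (clique e1) K ->
    maxset (clique e2) K' /\ corresponding psi K K')) => K.
  case: (boolP (maxset (clique e1) K)) => [maxK|_]; last by exists set0.
  have [K' ? ?] := corresponding_maxclique s1 s2 le1 nt1 psiK psiK' le2 maxK.
  by exists K'.
have corr_sym K K' : corresponding psi K K' -> corresponding psi' K' K.
  move=> corr c' c c'K' cK; have [H1 H2] := corr _ _ cK c'K'.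
  by rewrite -(psiK c); split; apply: le2.
(* The clique [K] attached to [K'] by [psi'] works: [special K'] is conjugate into
   [special (tau K)], and [K'] is maximal. *)
have tau_surj K' : maxset (clique e2) K' -> exists2 K, maxset (clique e1) K & tau K = K'.
  move=> maxK'.
  have [K maxK corr] := corresponding_maxclique s2 s1 le2 nt2 psiK' psiK le1 maxK'.
  exists K => //; have [maxT corrT] := tauP K maxK.
  apply: (maxsetsup maxK' (maxsetp maxT)); apply: (special_sub_conj irr2 nt2).
  pose c := CF_class (special_clique_finite gT1 irr1 (maxsetp maxK)).
  pose c' := CF_class (special_clique_finite gT2 irr2 (maxsetp maxK')).
  pose d' := CF_class (special_clique_finite gT2 irr2 (maxsetp maxT)).
  have cm : proj1_sig c _ := CF_class_mem _.
  have cm' : proj1_sig c' _ := CF_class_mem _.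
  have dm' : proj1_sig d' _ := CF_class_mem _.
  apply/(CF_leP cm' dm'); apply: CF_le_trans (proj1 (corrT _ _ cm dm')).
  by rewrite -(psiK' c'); apply: le1; have [] := corr _ _ cm' cm.
(* Both families are indexed by the maximal cliques of the first graph, through [tau] for [f2], so
   that their values can be compared. *)
pose f1 v := [set K | maxset (clique e1) K & v \in K].
pose f2 w := [set K | maxset (clique e1) K & w \in tau K].
have clique1 (V : finType) (e : rel V) v : clique e [set v].
  by apply/cliqueP => x y /set1P -> /set1P ->; rewrite eqxx.
have f1n v : f1 v != set0.
  have [M maxM] := maxclique_cover (clique1 _ e1 v); rewrite sub1set => vM.
  by apply/set0Pn; exists M; rewrite inE maxM.
have f2n w : f2 w != set0.
  have [M maxM] := maxclique_cover (clique1 _ e2 w); rewrite sub1set => wM.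
  have [K maxK E] := tau_surj M maxM.
  by apply/set0Pn; exists K; rewrite inE maxK E.
have [|s [bs sf sT]] := typed_bijection (gT1 := gT1) (gT2 := gT2) f1n f2n.
  move=> S kT /set0Pn [K0 K0S].
  (* If [S] has a member that is not a maximal clique, both counts vanish; otherwise they count the
     factors of the special subgroups over two corresponding intersections. *)
  case: (boolP [forall K in S, maxset (clique e1) K]) => [/forall_inP maxS|]; last first.
    case/forall_inPn => K KS nmax; rewrite !eq_card0 // => v; rewrite !inE;
    by apply/negP => /andP[_ /subsetP /(_ K KS)]; rewrite inE (negbTE nmax).
  pose I := \bigcap_(K in S) K; pose J := \bigcap_(K in S) tau K.
  have cI : clique e1 I.
    apply: clique_sub (maxsetp (maxS K0 K0S)); exact: bigcap_inf.
  have cJ : clique e2 J.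
    have [maxT _] := tauP K0 (maxS K0 K0S).
    apply: clique_sub (maxsetp maxT); exact: bigcap_inf.
  have <- : [set v in I | [set: gT1 v] \isog [set: kT]] =
      [set v | [set: gT1 v] \isog [set: kT] & S \subset f1 v].
    apply/setP => v; rewrite !inE andbC; congr (_ && _).
    apply/bigcapP/subsetP => H K KS; last by have := H K KS; rewrite inE => /andP[].
    by rewrite inE maxS // H.
  have <- : [set w in J | [set: gT2 w] \isog [set: kT]] =
      [set w | [set: gT2 w] \isog [set: kT] & S \subset f2 w].
    apply/setP => v; rewrite !inE andbC; congr (_ && _).
    apply/bigcapP/subsetP => H K KS; last by have := H K KS; rewrite inE => /andP[].
    by rewrite inE maxS // H.
  apply: krull_schmidt => //.
    apply: (embeds_prod_embed irr1 irr2 cI cJ).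
    apply: (corresponding_embeds s1 s2 le1 emb1 cI) => K KS.
    have maxK := maxS K KS; have [maxT corr] := tauP K maxK.
    by split=> //; apply: maxsetp.
  apply: (embeds_prod_embed irr2 irr1 cJ cI).
  apply: (corresponding_embeds s2 s1 le2 emb2 cJ) => K KS.
  have maxK := maxS K KS; have [maxT corr] := tauP K maxK.
  by split=> //; [apply: maxsetp | apply: maxsetp | apply: corr_sym].
exists s; split=> // x y.
have [->|xy] := eqVneq x y; first by rewrite irr1 irr2.
have sxy : s x != s y by rewrite (inj_eq (bij_inj bs)).
have mem v K : (K \in f1 v) = maxset (clique e1) K && (s v \in tau K).
  by rewrite -sf inE.
apply/idP/idP => [exy|exy].
  have /maxclique_cover [M maxM] : clique e1 [set x; y].
    by apply/cliqueP => u v /set2P[]-> /set2P[]->; rewrite ?eqxx // sym1.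
  rewrite subUset !sub1set => /andP[xM yM].
  have [maxT _] := tauP M maxM; have /cliqueP := maxsetp maxT; apply => //.
    by have := mem x M; rewrite inE maxM xM /= => <-.
  by have := mem y M; rewrite inE maxM yM /= => <-.
have /maxclique_cover [M maxM] : clique e2 [set s x; s y].
  by apply/cliqueP => u v /set2P[]-> /set2P[]->; rewrite ?eqxx // sym2.
rewrite subUset !sub1set => /andP[xM yM].
have [K maxK E] := tau_surj M maxM; have /cliqueP := maxsetp maxK; apply => //.
  by have := mem x K; rewrite inE maxK E xM /= => ->.
by have := mem y K; rewrite inE maxK E yM /= => ->.
Qed.

Theorem theorem2p4 (V1 V2 : finType) (e1 : rel V1) (e2 : rel V2)
    (gT1 : V1 -> finGroupType) (gT2 : V2 -> finGroupType) :
  simple_graph e1 -> simple_graph e2 ->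
  (forall v, nontrivial (gT1 v) /\ directly_indecomposable (gT1 v)) ->
  (forall v, nontrivial (gT2 v) /\ directly_indecomposable (gT2 v)) ->
  (grp_iso (graph_product e1 gT1) (graph_product e2 gT2) <->
     labelled_graph_iso e1 e2 gT1 gT2) /\
  (labelled_graph_iso e1 e2 gT1 gT2 <->
     CF_labelled_iso (graph_product e1 gT1) (graph_product e2 gT2)).
Proof.
move=> s1 s2 P1 P2.
have graph_of_CF := CF_iso_labelled_graph_iso s1 s2 P1 P2.
split; split.
- by move/grp_iso_CF/graph_of_CF.
- exact: labelled_graph_iso_grp_iso.
- by move/labelled_graph_iso_grp_iso/grp_iso_CF.
- exact: graph_of_CF.
Qed.
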